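(* Let $T>0$. There exists a pair $(u,I)$ solving $$\begin{cases}u_t=H(Du)+R(x,I(t)) & \text{in }\mathbb{R}^n\times[0,T],\\ \sup_{\mathbb{R}^n}u(\cdot,t)=0 & \text{on }[0,T],\\ I(0)=0,\\ u(x,0)=u_0(x) & \text{on }\mathbb{R}^n.\end{cases}$$
   Context: Notation: $\|f\|_{W^{1,\infty}(\mathbb{R}^n)}=\|f\|_{L^\infty(\mathbb{R}^n)}+\|Df\|_{L^\infty(\mathbb{R}^n)}$; $D$ is the gradient in $x$. Standing assumptions. $I_M>0$ is a constant, $R:\mathbb{R}^n\times[-2I_M,2I_M]\to\mathbb{R}$, $u_0:\mathbb{R}^n\to\mathbb{R}$, $H:\mathbb{R}^n\to[0,\infty)$, and: (i) there exist $K_1,K_2>0$ such that $-K_1\le R_I(x,I)\le -K_2$, where $R_I=\partial R/\partial I$; (ii) $\max_{\mathbb{R}^n}R(\cdot,I_M)=0$; (iii) $\min_{\mathbb{R}^n}R(\cdot,0)=0$; (iv) $\sup_{|I|\le 2I_M}\|R(\cdot,I)\|_{W^{1,\infty}(\mathbb{R}^n)}<\infty$; (v) $u_0\in W^{1,\infty}(\mathbb{R}^n)$ and $\sup_{\mathbb{R}^n}u_0=0$; (vi) $H$ is nonnegative, locally Lipschitz continuous, and $H(0)=0$. $R$ is extended continuously to $\mathbb{R}^n\times\mathbb{R}$ by $R(x,I)=R(x,2I_M)-I+2I_M$ for $I>2I_M$ and $R(x,I)=R(x,-2I_M)-2I_M-I$ for $I<-2I_M$. Notion of solution. In a solution pair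 $(u,I)$, $u$ is a bounded uniformly continuous function on $\mathbb{R}^n\times[0,T]$ and $I:[0,T]\to[0,\infty)$ is a nondecreasing, possibly discontinuous, function. The equation is understood in the viscosity sense for discontinuous Hamiltonians: with $I^*$ and $I_*$ the upper and lower semicontinuous envelopes of $I$, $u$ is a viscosity subsolution of $u_t=H(Du)+R(x,I_*(t))$ and a viscosity supersolution of $u_t=H(Du)+R(x,I^*(t))$ in $\mathbb{R}^n\times(0,T)$. The other three conditions hold pointwise. *)

(* Defs.v *)
From HB Require Import structures.
From mathcomp Require Import all_boot all_order all_algebra.
From mathcomp Require Import all_classical all_reals all_analysis.

Set Implicit Arguments.
Unset Strict Implicit.
Unset Printing Implicit Defensive.

Import Order.TTheory GRing.Theory Num.Theory.
Import numFieldNormedType.Exports.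

Local Open Scope classical_set_scope.
Local Open Scope ring_scope.

(* The library has no n-dimensional Lebesgue measure. It is obtained here on
   [n.-tuple R], which carries the product of the Borel sigma-algebras, by
   iterating the binary product measure along (x, t) |-> x :: t. *)
Section lebesgue_tuple.
Context {R : realType}.
Local Notation RM := (measurableTypeR R).

Definition cons_pair n (p : RM * n.-tuple RM) : n.+1.-tuple RM :=
  [tuple of p.1 :: p.2].

Lemma measurable_cons_pair n :
  measurable_fun [set: RM * n.-tuple RM] (@cons_pair n).
Proof. by apply: measurable_cons; [exact: measurable_fst|exact: measurable_snd]. Qed.

Section cons_measure.
Variables (n : nat) (m : {sigma_finite_measure set (n.-tuple RM) -> \bar R}).

Definition cons_measure : set (n.+1.-tuple RM) -> \bar R :=
  pushforward (@lebesgue_measure R \x m)%E (@cons_pair n).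

Let cons_measurable (A : set (n.+1.-tuple RM)) :
  measurable A -> measurable (@cons_pair n @^-1` A).
Proof. by move=> mA; rewrite -[X in measurable X]setTI; exact: measurable_cons_pair. Qed.

Let cons_measure0 : cons_measure set0 = 0%E.
Proof. by rewrite /cons_measure /pushforward preimage_set0 measure0. Qed.

Let cons_measure_ge0 A : (0 <= cons_measure A)%E.
Proof. by rewrite /cons_measure /pushforward; exact: measure_ge0. Qed.

Let cons_measure_sigma_additive : semi_sigma_additive cons_measure.
Proof.
move=> F mF tF mUF; rewrite /cons_measure /pushforward preimage_bigcup.
apply: measure_semi_sigma_additive.
- by move=> k; exact: cons_measurable.
- apply/trivIsetP => /= i j _ _ ij; rewrite -preimage_setI.
  by move/trivIsetP : tF => /(_ _ _ _ _ ij) ->//; rewrite preimage_set0.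
- by rewrite -preimage_bigcup; exact: cons_measurable.
Qed.

HB.instance Definition _ := isMeasure.Build _ _ _ cons_measure
  cons_measure0 cons_measure_ge0 cons_measure_sigma_additive.

Let cons_measure_sigma_finite : sigma_finite setT cons_measure.
Proof.
have [F [FT ndF Foo]] := (sigma_finiteP _ _).1 (sigma_finiteT (@lebesgue_measure R)).
have [G [GT ndG Goo]] := (sigma_finiteP _ _).1 (sigma_finiteT m).
have mth : measurable_fun [set: n.+1.-tuple RM]
    (fun t => (thead t, [tuple of behead t])).
  by apply: measurable_fun_pair;
    [exact: measurable_tnth|exact: measurable_behead].
exists (fun k => (fun t : n.+1.-tuple RM =>
    (thead t, [tuple of behead t])) @^-1` (F k `*` G k)).
  rewrite -preimage_bigcup [X in _ @^-1` X](_ : _ = setT) ?preimage_setT//.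
  rewrite -setXTT FT GT predeqE => -[x y]; split; first by move=> [k _ []]; split; exists k.
  move=> [/= [k _ Fkx] [l _ Gly]]; exists (maxn k l) => //; split.
    by move: x Fkx; exact/subsetPset/ndF/leq_maxl.
  by move: y Gly; exact/subsetPset/ndG/leq_maxr.
move=> k; have [mF Fk] := Foo k; have [mG Gk] := Goo k; split.
  by rewrite -[X in measurable X]setTI; apply: mth => //; exact: measurableX.
rewrite /cons_measure /pushforward -comp_preimage.
rewrite (_ : _ \o _ = id) ?preimage_id.
  by rewrite product_measure1E// lte_mul_pinfty// ge0_fin_numE.
apply/funext => -[x t] /=; rewrite /cons_pair theadE /=; congr pair.
exact/val_inj.
Qed.

HB.instance Definition _ :=
  Measure_isSigmaFinite.Build _ _ _ cons_measure cons_measure_sigma_finite.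

End cons_measure.

Fixpoint lebesgue_tuple n :
    {sigma_finite_measure set (n.-tuple RM) -> \bar R} :=
  match n with
  | 0 => \d_[tuple]
  | m.+1 => cons_measure (lebesgue_tuple m)
  end.

End lebesgue_tuple.

Section definitions.
Context {R : realType}.

(* In finite dimension this is the usual class C^1 on the open set D. *)
Definition C1_on (V : normedModType R) (D : set V) (f : V -> R) :=
  forall p, D p ->
    differentiable f p /\ forall v, {for p, continuous (fun q => 'D_v f q)}.

Definition euclidean_norm n (v : 'rV[R]_n) : R :=
  Num.sqrt (\sum_(i < n) v ord0 i ^+ 2).

Definition rV_of_tuple n (t : n.-tuple (measurableTypeR R)) : 'rV[R]_n :=
  \row_(i < n) tnth t i.

Definition Linfty_norm n (h : 'rV[R]_n -> R) : \bar R :=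
  Lnorm (lebesgue_tuple n) +oo%E (fun t => (h (rV_of_tuple t))%:E).

(* The test functions are C^1 with compact support. The integrals are only
   meaningful for locally integrable f and g, which is the case for the
   essentially bounded f and g that matter in W1oo_norm below. *)
Definition weak_gradient n (f : 'rV[R]_n -> R) (g : 'rV[R]_n -> 'rV[R]_n) :=
  measurable_fun setT (f \o @rV_of_tuple n) /\
  forall i : 'I_n,
    measurable_fun setT (fun t => g (@rV_of_tuple n t) ord0 i) /\
    forall phi : 'rV[R]_n -> R,
      C1_on setT phi -> compact (closure [set x | phi x != 0]) ->
      (\int[lebesgue_tuple n]_t
         (f (rV_of_tuple t) * 'D_(delta_mx ord0 i) phi (rV_of_tuple t))%:E =
       - \int[lebesgue_tuple n]_t
         (g (rV_of_tuple t) ord0 i * phi (rV_of_tuple t))%:E)%E.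

(* Weak gradients are unique up to a null set, so the infimum is over equal
   values; it is +oo when there is no weak gradient. *)
Definition W1oo_norm n (f : 'rV[R]_n -> R) : \bar R :=
  ereal_inf [set (Linfty_norm f + Linfty_norm (@euclidean_norm n \o g))%E
            | g in weak_gradient f].

(* One-sided at the end points when A is a segment. *)
Definition has_derivative_within (A : set R) (f : R -> R) (a l : R) :=
  (fun b => (f b - f a) / (b - a)) @ within A a^' --> l.

Definition locally_lipschitz (V : normedModType R) (f : V -> R) :=
  forall p : V, exists2 U, nbhs p U & [lipschitz f q | q in U].

Definition extend_rate n (IM : R) (r : 'rV[R]_n -> R -> R) x I : R :=
  if 2 * IM < I then r x (2 * IM) - I + 2 * IM
  else if I < - (2 * IM) then r x (- (2 * IM)) - 2 * IM - I
  else r x I.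

Definition bounded_uniformly_continuous_on
    (V : normedModType R) (D : set V) (f : V -> R) :=
  [bounded f p | p in D] /\
  forall e : R, 0 < e -> exists2 d : R, 0 < d &
    forall p q, D p -> D q -> `|p - q| < d -> `|f p - f q| < e.

(* The filter [within A (nbhs t)] does not exclude t itself. *)
Definition usc_envelope (A : set R) (f : R -> R) (t : R) : R :=
  fine (limf_esup (EFin \o f) (within A (nbhs t))).

Definition lsc_envelope (A : set R) (f : R -> R) (t : R) : R :=
  fine (limf_einf (EFin \o f) (within A (nbhs t))).

Definition space_gradient n (phi : 'rV[R]_n * R -> R) p : 'rV[R]_n :=
  \row_(i < n) 'D_((delta_mx ord0 i, 0) : 'rV[R]_n * R) phi p.

Definition time_derivative n (phi : 'rV[R]_n * R -> R) p : R :=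
  'D_((0, 1) : 'rV[R]_n * R) phi p.

Definition space_time n (T : set R) : set ('rV[R]_n * R) := [set p | T p.2].

(* u_t <= F(x, t, Du) in R^n x (0, T) *)
Definition viscosity_subsolution n (T : R) (F : 'rV[R]_n -> R -> 'rV[R]_n -> R)
    (u : 'rV[R]_n * R -> R) :=
  forall (phi : 'rV[R]_n * R -> R) (p : 'rV[R]_n * R),
    C1_on (space_time `]0, T[) phi -> space_time `]0, T[ p ->
    (\forall q \near p, u q - phi q <= u p - phi p) ->
    time_derivative phi p <= F p.1 p.2 (space_gradient phi p).

(* u_t >= F(x, t, Du) in R^n x (0, T) *)
Definition viscosity_supersolution n (T : R) (F : 'rV[R]_n -> R -> 'rV[R]_n -> R)
    (u : 'rV[R]_n * R -> R) :=
  forall (phi : 'rV[R]_n * R -> R) (p : 'rV[R]_n * R),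
    C1_on (space_time `]0, T[) phi -> space_time `]0, T[ p ->
    (\forall q \near p, u p - phi p <= u q - phi q) ->
    F p.1 p.2 (space_gradient phi p) <= time_derivative phi p.

End definitions.

(* Main.v *)
Require Import Defs.
From HB Require Import structures.
From mathcomp Require Import all_boot all_order all_algebra.
From mathcomp Require Import all_classical all_reals all_analysis.
From mathcomp Require Import measurable_realfun ess_sup_inf.
From mathcomp Require Import lra ring.

Set Implicit Arguments.
Unset Strict Implicit.
Unset Printing Implicit Defensive.

Import Order.TTheory GRing.Theory Num.Theory.
Import numFieldNormedType.Exports.

Local Open Scope classical_set_scope.
Local Open Scope ring_scope.

(** The solution is a limit of a monotone scheme in which the multiplier is chosen
    at every time step. Let [tau] be the time step and [A] the Lax-Friedrichs operator
    of [u_t = H(Du)], and put [u_{k+1} = max(u_k, A u_k) + tau R(., I_k)]. As [H >= 0],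
    the maximum is consistent with the equation; as [H(0) = 0], it does not increase
    [sup u]. If [sup u_k = 0] then [tau R(x, I_{k-1})] is almost nonnegative at
    near-maximum points [x] of [u_k], so the choice [I = I_{k-1}] gives
    [sup u_{k+1} >= 0], while [I = I_M] gives [sup u_{k+1} <= 0]. Hence some [I_k] in
    [[I_{k-1}, I_M]] achieves [sup u_{k+1} = 0], and the multipliers are nondecreasing.

    The limit is taken along an ultrafilter. No comparison principle is needed: a test
    function violating a viscosity inequality is compared with the scheme on a backward
    discrete cone. The constraint [sup u = 0] survives although near-maximum points may
    escape to infinity, by finite speed of propagation and the compactness of the
    translates of the data.

    [H] is first truncated to the gradients bounded by a Lipschitz constant of the
    solution. The W^{1,oo} hypotheses are used through Lipschitz bounds, obtained by
    testing the weak gradient against products of one-dimensional bumps. *)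

(** * Norms, ultrafilter limits and truncation *)

(** The Lipschitz constant in [x] that the scheme propagates comes from monotonicity and translation
    invariance alone: it depends on [u0], [r], [n] and [T] but not on [H]. This breaks the circle
    between truncating [H], which fixes [L], and bounding the gradients of the solution, on which
    the truncation depends. Plain averaging would lower the supremum of [u_k] and could leave no
    feasible multiplier above the previous one; the maximum with [u_k] keeps near-maximum points
    near-maximum. The space step is proportional to the time step, so information travels at speed
    [n * L] and comparison on a cone requires no lateral boundary data. Along an ultrafilter every
    bounded sequence converges, so the limits at all points and times exist at once. The multipliers
    converge only pointwise in time, but on a backward cone monotonicity places them between their
    values at its base and at its apex; one-sided bounds at these two times suffice for the
    viscosity inequalities. Tilting the test function by [eta] in time gains [eta] times the height
    of the cone, which outweighs the error of the limit. *)

Section rV_norm.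
Context {R : realType} {n : nat}.
Implicit Types v : 'rV[R]_n.

Lemma rV_norm_le v d : 0 <= d -> (forall j, `|v ord0 j| <= d) -> `|v| <= d.
Proof.
move=> d0 H; rewrite [leLHS]/Num.norm /= mx_normrE; apply/bigmax_leP; split => //.
by move=> [i j] _ /=; rewrite ord1.
Qed.

Lemma rV_coord_le v j : `|v ord0 j| <= `|v|.
Proof.
rewrite [leRHS]/Num.norm /= mx_normrE; apply/bigmax_geP; right => /=.
by exists (ord0, j).
Qed.

Lemma rV_norm_delta_le1 i : `|delta_mx ord0 i : 'rV[R]_n| <= 1.
Proof.
apply: rV_norm_le => // j; rewrite mxE eqxx /=.
by case: eqP => _; rewrite ?normr1 ?normr0.
Qed.

Lemma rV_norm_scale_delta_le (s : R) i : `|s *: delta_mx ord0 i : 'rV[R]_n| <= `|s|.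
Proof. by rewrite normrZ ler_piMr// rV_norm_delta_le1. Qed.

End rV_norm.

Section ultrafilter_limits.
Context {R : realType}.

(** Compactness of a segment gives a cluster point of the image of [U]. A cluster point of an
    ultrafilter is a limit: of the set where [u] is [e]-close to it and the complement, one lies in
    [U], and the complement contradicts clustering. *)
Lemma ultra_bounded_cvg (U : set_system nat) (u : nat -> R) (B : R) :
  UltraFilter U -> (forall k, `|u k| <= B) -> cvg (u @ U).
Proof.
move=> UU uB.
have uI : (u @ U) `[- B, B]%classic.
  apply: (@filterS _ U _ setT) => [k _|]; last exact: filterT.
  by rewrite /= in_itv/= -ler_norml.
have [l [_ cl]] := @segment_compact R (- B) B (u @ U) _ uI.
apply/cvg_ex; exists l; apply/cvgrPdist_lt => e e0.
have [//|US] := in_ultra_setVsetC [set k | `|l - u k| < e] UU.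
have [y [/= ny ye]] := cl (~` ball l e) (ball l e) US (nbhsx_ballx l e e0).
by case: ny.
Qed.

Lemma cvg_ultra_le (U : set_system nat) (u v : nat -> R) (a b : R) :
  UltraFilter U -> u @ U --> a -> v @ U --> b ->
  (\forall k \near U, u k <= v k) -> a <= b.
Proof. by move=> UU ua vb uv; exact: (ler_cvg_to ua vb uv). Qed.

Lemma cvg_ultra_norm_le (U : set_system nat) (u : nat -> R) (a c : R) :
  UltraFilter U -> u @ U --> a -> (\forall k \near U, `|u k| <= c) -> `|a| <= c.
Proof.
move=> UU ua uc; have nua : `|u k| @[k --> U] --> `|a| by exact: cvg_norm.
exact: (cvg_ultra_le UU nua (cvg_cst _)).
Qed.

(** An [e / 3] argument on small balls, glued by the covering form of compactness. The sign of [C]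
    is unknown, hence [|C| + 1] in the radius. *)
Lemma compact_equilipschitz_cvg (V : normedModType R) (A : set V)
    (U : set_system nat) (f : nat -> V -> R) (l : V -> R) (C e : R) :
  compact A -> Filter U -> 0 < e ->
  (forall k x y, `|f k x - f k y| <= C * `|x - y|) ->
  (forall x y, `|l x - l y| <= C * `|x - y|) ->
  (forall x, (f ^~ x) @ U --> l x) ->
  \forall k \near U, forall x, A x -> `|f k x - l x| <= e.
Proof.
move=> /compact_near_coveringP cA FU e0 fC lC fl.
have e3 : 0 < e / 3 by rewrite divr_gt0.
apply: (cA nat U (fun k x => `|f k x - l x| <= e) FU) => x Ax.
have C0 : 0 < `|C| + 1 by rewrite ltr_wpDl.
exists (ball x (e / 3 / (`|C| + 1)), [set k | `|l x - f k x| <= e / 3]).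
  split; first by apply: nbhsx_ballx; rewrite divr_gt0.
  by have /cvgrPdist_le/(_ _ e3) := fl x.
move=> [y k] /= [] xy fk.
have Cxy : C * `|x - y| <= e / 3.
  move: xy; rewrite -ball_normE/= => xy.
  apply: (@le_trans _ _ ((`|C| + 1) * `|x - y|)).
    by rewrite ler_wpM2r// (le_trans (ler_norm _))// lerDl.
  by rewrite mulrC -ler_pdivlMr// ltW.
have := fC k x y; have := lC x y.
move: fk Cxy; rewrite !ler_norml; lra.
Qed.

End ultrafilter_limits.

(** * From local to uniform Lipschitz bounds *)

Section lipschitz_compact.
Context {R : realType}.

Lemma locally_lipschitz_continuous (V : normedModType R) (f : V -> R) :
  locally_lipschitz f -> continuous f.
Proof.
move=> lf x; have [U Ux] := lf x.
move=> [M [_ HM]].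
pose K := Num.max (M + 1) 1.
have MK : M < K by rewrite lt_max ltrDl ltr01.
have K0 : 0 < K by rewrite lt_max ltr01 orbT.
have {}HM := HM K MK.
apply/cvgrPdist_le => e e0; near=> y.
have Uy : U y by near: y.
have := HM (x, y) (conj (nbhs_singleton Ux) Uy).
rewrite /self_sub/= => /le_trans; apply.
rewrite mulrC -ler_pdivlMr//; near: y.
have := nbhsx_ballx x (e / K) (divr_gt0 e0 K0).
by apply: filterS => z; rewrite -ball_normE/= => /ltW.
Unshelve. all: by end_near. Qed.

(** [A] need not be convex, so local constants cannot be chained along segments. Instead [A * A] is
    covered: near the diagonal a local constant works; away from it [|x - y|] is bounded below while
    [f x - f y] is bounded, so every large constant works. *)
Lemma locally_lipschitz_compact (V : normedModType R) (f : V -> R) (A : set V) :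
  locally_lipschitz f -> compact A ->
  exists2 L, 0 < L & forall x y, A x -> A y -> `|f x - f y| <= L * `|x - y|.
Proof.
move=> lf cA.
have cf := locally_lipschitz_continuous lf.
have /compact_near_coveringP H := compact_setX cA cA.
have : \forall L \near +oo, A `*` A `<=` [set z | `|f z.1 - f z.2| <= L * `|z.1 - z.2|].
  apply: H => -[p q] _.
  have [<-|pq] := eqVneq p q.
    have [U Up [M [_ HM]]] := lf p.
    exists (U `*` U, [set L | M < L]).
      split; first by exists (U, U).
      by exists M; split => //; exact: num_real.
    move=> [[a b] L] /= [[Ua Ub] ML].
    exact: (HM L ML (a, b) (conj Ua Ub)).
  have pq0 : 0 < `|p - q| by rewrite normr_gt0 subr_eq0.
  pose d := `|p - q| / 4.
  have d0 : 0 < d by rewrite divr_gt0.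
  have dE : `|p - q| = 4 * d by rewrite /d mulrC divfK.
  (* Near [(p, q)] the increment of [f] is at most [|f p - f q| + 2] and the distance is at least
     [2 * d]. *)
  pose M := (`|f p - f q| + 2) / (2 * d).
  pose near_value z := ball z d `&` [set x | `|f z - f x| <= 1].
  exists (near_value p `*` near_value q, [set L | M < L]).
    split; last by exists M; split => //; exact: num_real.
    have nbhs_value z : nbhs z (near_value z).
      by apply: filterI; [exact: nbhsx_ballx|have /cvgrPdist_le/(_ 1 ltr01) := cf z].
    by exists (near_value p, near_value q).
  move=> [[a b] L] [[[+ /= fa] [+ /= fb]] /= ML]; rewrite -!ball_normE/= => pa qb.
  have ab : 2 * d <= `|a - b|.
    have := ler_normD (p - a) (a - b); have := ler_normD (p - b) (b - q).
    rewrite !addrA !subrK (distrC b q); move: pa qb; rewrite dE; lra.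
  have L0 : 0 <= L.
    by apply/ltW/(le_lt_trans _ ML); rewrite /M divr_ge0// ?addr_ge0// mulr_ge0// ltW.
  apply: (le_trans _ (ler_wpM2l L0 ab)).
  have : M * (2 * d) <= L * (2 * d).
    by apply: ler_wpM2r; [rewrite mulr_ge0// ltW|exact: ltW].
  rewrite {1}/M divfK; last by rewrite mulf_neq0// gt_eqF.
  apply: le_trans; move: fa fb.
  have := ler_norm (f p - f q); have := ler_norm (- (f p - f q)); rewrite normrN.
  rewrite !ler_norml; lra.
move=> [M [_ HM]]; exists (Num.max (M + 1) 1); first by rewrite lt_max ltr01 orbT.
have MK : M < Num.max (M + 1) 1 by rewrite lt_max ltrDl ltr01.
by move=> x y Ax Ay; exact: (HM _ MK (x, y) (conj Ax Ay)).
Qed.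

End lipschitz_compact.

Section truncation.
Context {R : realType} {n : nat}.

Lemma clamp_lipschitz (l h a b : R) :
  `|Num.max l (Num.min h a) - Num.max l (Num.min h b)| <= `|a - b|.
Proof.
have maxL c d : `|Num.max l c - Num.max l d| <= `|c - d|.
  have := ler_norm (c - d); have := ler_norm (- (c - d)); rewrite normrN ler_norml.
  by have [h1|h1] := leP l c; have [h2|h2] := leP l d; lra.
have minL c d : `|Num.min h c - Num.min h d| <= `|c - d|.
  have := ler_norm (c - d); have := ler_norm (- (c - d)); rewrite normrN ler_norml.
  by have [h1|h1] := leP h c; have [h2|h2] := leP h d; lra.
exact: le_trans (maxL _ _) (minL _ _).
Qed.

(** Clamping each coordinate is 1-Lipschitz for the maximum norm carried by row vectors, and matches
    gradient bounds obtained one coordinate at a time. *)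
Definition truncate (K : R) (p : 'rV[R]_n) : 'rV[R]_n :=
  \row_i Num.max (- K) (Num.min K (p ord0 i)).

Lemma truncate_norm K (p : 'rV[R]_n) : 0 <= K -> `|truncate K p| <= K.
Proof.
move=> K0; apply: rV_norm_le => // j; rewrite mxE ler_norml.
by rewrite le_max lexx/= ge_max ge_min lexx andbT; lra.
Qed.

Lemma truncate_id K (p : 'rV[R]_n) : (forall j, `|p ord0 j| <= K) -> truncate K p = p.
Proof.
move=> pK; apply/rowP => j; rewrite mxE; have := pK j; rewrite ler_norml.
by move=> /andP[h1 h2]; rewrite min_r// max_r.
Qed.

Lemma truncate_lipschitz K (p q : 'rV[R]_n) : 0 <= K ->
  `|truncate K p - truncate K q| <= `|p - q|.
Proof.
move=> K0; apply: rV_norm_le => // j.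
apply: le_trans (rV_coord_le _ j); rewrite !mxE.
exact: clamp_lipschitz.
Qed.

End truncation.

Section derivative_within.
Context {R : realType}.

Lemma has_derivative_within_is_derive (a b c l : R) (f : R -> R) :
  a < c < b -> has_derivative_within `[a, b] f c l -> is_derive c 1 f l.
Proof.
move=> /andP[ac cb] fl.
suff L : (fun h => h^-1 *: (f (h *: 1 + c) - f c)) @ 0^' --> l.
  by apply: DeriveDef; [exact/cvgP/L | exact: cvg_lim L].
apply/cvgrPdist_le => e e0.
move/cvgrPdist_le : fl => /(_ e e0)/nbhs_ballP[d /= d0 H].
pose d' := Num.min d (Num.min (c - a) (b - c)).
have d'0 : 0 < d' by rewrite !lt_min d0 !subr_gt0 ac.
near=> h.
have h0 : h != 0 by near: h; exact: nbhs_dnbhs_neq.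
have : `|h| < d' by near: h; exact: dnbhs0_lt.
rewrite !lt_min !ltr_norml => /andP[hd /andP[hac hbc]].
have := H (h + c); rewrite -ball_normE/= opprD addrCA subrr addr0 normrN.
rewrite ltr_norml hd => /(_ isT); rewrite addrK.
rewrite (_ : h%:A = h); last by rewrite /GRing.scale/= mulr1.
rewrite /GRing.scale/= mulrC; apply.
  by apply/eqP => E; move/eqP : h0; apply; lra.
by rewrite in_itv/=; lra.
Unshelve. all: by end_near. Qed.

(** Mean value theorem strictly inside the interval. It is applied to multipliers in [[0, IM]], away
    from [-2 IM] and [2 IM], where the derivative of the rate is only one-sided. *)
Lemma derivative_bounds_increment (f : R -> R) (a b K1 K2 s t : R) :
  (forall c, c \in `]a, b[ -> exists2 l, is_derive c 1 f l & - K1 <= l <= - K2) ->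
  a < s -> t < b -> s <= t -> 0 <= K2 ->
  0 <= f s - f t <= K1 * (t - s).
Proof.
move=> df sa tb st K20.
have ds c : c \in `[s, t] -> c \in `]a, b[.
  by rewrite !in_itv/= => /andP[h1 h2]; rewrite (lt_le_trans sa h1) (le_lt_trans h2 tb).
have dv c : c \in `[s, t] -> derivable f c 1.
  by move=> /ds /df[l [dl _] _].
have [c cst E] : exists2 c, c \in `[s, t] & f t - f s = 'D_1 f c * (t - s).
  apply: MVT_segment => //.
    by move=> x xst; apply/derivableP/dv; exact: subset_itv_oo_cc xst.
  exact: derivable_within_continuous.
have [l [_ dl] /andP[l1 l2]] := df c (ds c cst).
move: E; rewrite dl => E.
by apply/andP; split; nra.
Qed.

End derivative_within.

(** * Functions with a bounded weak gradient are Lipschitz *)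

Section product_integral.
Context {R : realType}.
Local Notation RM := (measurableTypeR R).

Lemma measurable_prod_tnth n (F : 'I_n -> R -> R) :
  (forall j, measurable_fun setT (F j)) ->
  measurable_fun setT (fun t : n.-tuple RM => \prod_j F j (tnth t j)).
Proof.
move=> mF; apply: measurable_prod => j _.
exact: (measurableT_comp (mF j) (measurable_tnth j)).
Qed.

(** Tonelli, by induction on [n]: the measure in dimension [n.+1] is the image of a product measure
    under [cons_pair]. Nonnegativity spares integrability conditions. *)
Lemma integral_lebesgue_tuple_prod n (F : 'I_n -> R -> R) (m : 'I_n -> R) :
  (forall j, measurable_fun setT (F j)) ->
  (forall j x, 0 <= F j x) ->
  (forall j, (\int[@lebesgue_measure R]_x (F j x)%:E = (m j)%:E)%E) ->
  (\int[@lebesgue_tuple R n]_t (\prod_j F j (tnth t j))%:E = (\prod_j m j)%:E)%E.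
Proof.
elim: n F m => [|n IH] F m mF F0 Fm.
  under eq_integral do rewrite big_ord0.
  by rewrite big_ord0 integral_cst//= diracE mem_set// mule1.
rewrite [lebesgue_tuple _]/= [LHS]ge0_integral_pushforward//=; last 3 first.
- exact: measurable_cons_pair.
- by apply/measurable_EFinP; exact: measurable_prod_tnth.
- by move=> t _; rewrite lee_fin prodr_ge0.
rewrite preimage_setT fubini_tonelli1//=; last 2 first.
- apply/measurable_EFinP.
  exact: (measurableT_comp (measurable_prod_tnth mF) (@measurable_cons_pair R n)).
- by move=> t; rewrite lee_fin prodr_ge0.
rewrite /fubini_F /=.
have E x : (\int[lebesgue_tuple n]_y
    (\prod_(j < n.+1) F j (tnth (cons_pair (x, y)) j))%:E =
    (F ord0 x)%:E * (\prod_(j < n) m (lift ord0 j))%:E)%E.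
  rewrite -(IH (fun j => F (lift ord0 j)))// -ge0_integralZl//; last 3 first.
  - by apply/measurable_EFinP; exact: (measurable_prod_tnth (F := fun j => F (lift ord0 j))).
  - by move=> t _; rewrite lee_fin prodr_ge0.
  - by rewrite lee_fin.
  apply: eq_integral => t _; rewrite big_ord_recl tnth0 EFinM; congr (_ * _%:E)%E.
  by apply: eq_bigr => j _; rewrite tnthS.
under eq_integral do rewrite E.
rewrite ge0_integralZr//; last 3 first.
- by apply/measurable_EFinP; exact: mF.
- by move=> x _; rewrite lee_fin.
- rewrite lee_fin prodr_ge0// => j _.
  by rewrite -lee_fin -Fm integral_ge0// => x _; rewrite lee_fin.
by rewrite Fm big_ord_recl EFinM.
Qed.

End product_integral.

(** * Piecewise quadratic bumps in one variable *)

Section bump.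
Context {R : realType}.
Implicit Types (x t e a b : R).

(** A quadratic remainder is checked by case analysis, which covers the point where
    [Num.max 0 t ^+ 2] changes its formula. *)
Lemma is_derive_quadratic (f : R -> R) (x l C : R) :
  (forall h, `|f (x + h) - f x - l * h| <= C * h ^+ 2) -> is_derive x 1 f l.
Proof.
move=> H.
have C0 : 0 <= C.
  by have := H 1; rewrite expr1n !mulr1; exact: le_trans.
suff L : (fun h => h^-1 *: (f (h *: 1 + x) - f x)) @ 0^' --> l.
  by apply: DeriveDef; [exact/cvgP/L | exact: cvg_lim L].
apply/cvgrPdist_le => e e0.
have C1 : 0 < C + 1 by lra.
near=> h.
have h0 : h != 0 by near: h; exact: nbhs_dnbhs_neq.
have -> : l - h^-1 *: (f (h *: 1 + x) - f x) =
    - (h^-1 * (f (x + h) - f x - l * h)).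
  rewrite /GRing.scale /= mulr1 (addrC h x).
  by move: (f (x + h)) (f x) => A B; field.
rewrite normrN normrM normfV ler_pdivrMl ?normr_gt0//.
apply: (le_trans (H h)).
rewrite -real_normK ?num_real// expr2 mulrCA ler_wpM2l//.
have he : `|h| <= e / (C + 1).
  near: h.
  by apply: dnbhs0_le; exact: divr_gt0.
apply: (le_trans (ler_wpM2l C0 he)).
by rewrite mulrA ler_pdivrMr//; nra.
Unshelve. all: by end_near. Qed.

Lemma is_derive_maxr0_sqr t : is_derive t 1 (fun s => Num.max 0 s ^+ 2) (2 * Num.max 0 t).
Proof.
apply: (@is_derive_quadratic _ _ _ 1) => h; rewrite mul1r ler_norml.
have [A1|A1] := leP 0 t; have [A2|A2] := leP 0 (t + h); apply/andP; split; nra.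
Qed.

(** A second difference of [max(0, t)^2]: a C^1 step rising from [0] to [2 e^2] across [[0, 2e]].
    Its derivative [bump_hat] is the tent on [[0, 2e]] with peak [2e] at [e]. Test functions are
    only C^1, so piecewise quadratics can replace mollifiers. *)
Definition bump_step e t :=
  Num.max 0 t ^+ 2 - 2 * Num.max 0 (t - e) ^+ 2 + Num.max 0 (t - 2 * e) ^+ 2.
Definition bump_hat e t :=
  2 * Num.max 0 t - 4 * Num.max 0 (t - e) + 2 * Num.max 0 (t - 2 * e).

Lemma is_derive_comp_subr (f : R -> R) (l t c : R) :
  is_derive (t - c) 1 f l -> is_derive t 1 (fun s => f (s - c)) l.
Proof.
move=> fl; rewrite -[l]mulr1.
have h : is_derive t 1 (fun s : R => s - c) 1.
  by apply: is_derive_eq; rewrite subr0.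
exact: (@is_derive1_comp _ f (fun s => s - c) t l 1).
Qed.

Lemma is_derive_bump_step e t : is_derive t 1 (bump_step e) (bump_hat e t).
Proof.
have H := is_derive_maxr0_sqr.
pose f s : R := Num.max 0 s ^+ 2.
have d c := is_derive_comp_subr (H (t - c)).
rewrite /bump_step.
rewrite (_ : bump_hat e t = 2 * Num.max 0 t - 2 *: (2 * Num.max 0 (t - e))
    + 2 * Num.max 0 (t - 2 * e)); last first.
  rewrite /bump_hat /GRing.scale/=; ring.
have de := d e.
have := is_deriveD (is_deriveB (H t) (@is_deriveZ _ _ _ _ 2 _ _ _ de)) (d (2 * e)).
exact.
Qed.

Lemma bump_hat_ge0 e t : 0 < e -> 0 <= bump_hat e t.
Proof.
move=> e0; rewrite /bump_hat.
have [A1|A1] := leP 0 t; have [A2|A2] := leP 0 (t - e);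
  have [A3|A3] := leP 0 (t - 2 * e); lra.
Qed.

Lemma bump_hat_eq0 e t : 0 < e -> t <= 0 \/ 2 * e <= t -> bump_hat e t = 0.
Proof.
move=> e0 h; rewrite /bump_hat; case: h => h;
have [A1|A1] := leP 0 t; have [A2|A2] := leP 0 (t - e);
  have [A3|A3] := leP 0 (t - 2 * e); lra.
Qed.

Lemma bump_step_le0 e t : 0 < e -> t <= 0 -> bump_step e t = 0.
Proof.
move=> e0 h; rewrite /bump_step.
have [A1|A1] := leP 0 t; have [A2|A2] := leP 0 (t - e);
  have [A3|A3] := leP 0 (t - 2 * e); nra.
Qed.

Lemma bump_step_ge e t : 0 < e -> 2 * e <= t -> bump_step e t = 2 * e ^+ 2.
Proof.
move=> e0 h; rewrite /bump_step.
have [A1|A1] := leP 0 t; have [A2|A2] := leP 0 (t - e);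
  have [A3|A3] := leP 0 (t - 2 * e); nra.
Qed.

Lemma bump_step_homo e s t : 0 < e -> s <= t -> bump_step e s <= bump_step e t.
Proof.
move=> e0 st.
have [c _] := @MVT_segment R (bump_step e) (bump_hat e) _ _ st
  (fun x _ => is_derive_bump_step e x)
  (derivable_within_continuous (fun x _ => @ex_derive _ _ _ _ _ _ _ (is_derive_bump_step e x))).
by move/eqP; rewrite subr_eq => /eqP ->; rewrite lerDr mulr_ge0 ?subr_ge0 ?bump_hat_ge0.
Qed.

Lemma continuous_bump_hat e : continuous (bump_hat e).
Proof.
move=> t; rewrite /bump_hat.
have c k : {for t, continuous (fun x : R => Num.max 0 (x - k))}.
  apply: (@continuous_max R R (cst 0) (fun x => x - k)); first exact: cvg_cst.
  by apply: cvgB; [exact: cvg_id|exact: cvg_cst].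
have c0 : {for t, continuous (fun x : R => Num.max 0 x)}.
  by apply: (@continuous_max R R (cst 0) id); [exact: cvg_cst|exact: cvg_id].
apply: cvgD; first apply: cvgB.
- by apply: cvgM; [exact: cvg_cst|exact: c0].
- by apply: cvgM; [exact: cvg_cst|exact: c].
- by apply: cvgM; [exact: cvg_cst|exact: c].
Qed.

End bump.

Section bump_integral.
Context {R : realType}.
Local Notation mu := (@lebesgue_measure R).
Implicit Types (x t e a b : R).

Lemma integral_support_itv (f : R -> R) a b : (forall x, ~~ (a <= x <= b) -> f x = 0) ->
  (\int[mu]_x (f x)%:E = \int[mu]_(x in `[a, b]) (f x)%:E)%E.
Proof.
move=> f0; rewrite [RHS]integral_mkcond; apply: eq_integral => x _.
rewrite patchE; case: ifPn => //; rewrite notin_setE/= in_itv/= => /negP/f0 ->//.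
Qed.

Lemma integral_bump_hat e a : 0 < e ->
  (\int[mu]_x (bump_hat e (x - a))%:E = (2 * e ^+ 2)%:E)%E.
Proof.
move=> e0.
rewrite (@integral_support_itv _ a (a + 2 * e)); last first.
  move=> x; rewrite negb_and -!ltNge => /orP[] h; apply: bump_hat_eq0 => //.
    by left; lra.
  by right; lra.
have d t := is_derive_comp_subr (is_derive_bump_step e (t - a)).
have c : continuous (fun t => bump_step e (t - a)).
  by move=> t; apply/differentiable_continuous/derivable1_diffP; case: (d t).
rewrite (@continuous_FTC2 _ _ (fun t => bump_step e (t - a))).
- transitivity ((bump_step e (2 * e))%:E - (bump_step e 0)%:E)%E.
    by congr (_%:E - _%:E)%E; congr (bump_step _ _); ring.
  by rewrite (bump_step_le0 e0 (lexx 0)) (bump_step_ge e0 (lexx _)) sube0.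
- by rewrite ltrDl; lra.
- apply: continuous_subspaceT => t.
  apply: (@continuous_comp _ _ _ (fun s : R => s - a) (bump_hat e)).
    by apply: cvgB; [exact: cvg_id|exact: cvg_cst].
  exact: continuous_bump_hat.
- split.
  + by move=> t _; case: (d t).
  + exact/cvg_at_right_filter/c.
  + exact/cvg_at_left_filter/c.
- by move=> t _; rewrite derive1E; exact: derive_val.
Qed.

(** The derivative is a tent starting at [a] minus the same tent starting at [b]; integrating
    against it therefore compares averages of equal mass near the two ends. *)
Definition bump e a b t := bump_step e (t - a) - bump_step e (t - b).

Lemma bump_ge0 e a b t : 0 < e -> a <= b -> 0 <= bump e a b t.
Proof. by move=> e0 ab; rewrite subr_ge0 bump_step_homo// lerB. Qed.

Lemma bump_le e a b t : 0 < e -> bump e a b t <= 2 * e ^+ 2.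
Proof.
move=> e0; rewrite /bump lerBlDr -[leLHS]add0r addrC lerD//.
  have [h|/ltW h] := leP (2 * e) (t - a); first by rewrite bump_step_ge.
  by rewrite -(bump_step_ge e0 (lexx _)) bump_step_homo.
have [h|/ltW h] := leP (t - b) 0; first by rewrite bump_step_le0.
by rewrite -(bump_step_le0 e0 (lexx _)) bump_step_homo.
Qed.

Lemma bump_eq0 e a b t : 0 < e -> a <= b -> ~~ (a <= t <= b + 2 * e) -> bump e a b t = 0.
Proof.
move=> e0 ab; rewrite negb_and -!ltNge => /orP[] h; rewrite /bump.
  by rewrite !bump_step_le0 ?subrr//; lra.
by rewrite !bump_step_ge ?subrr//; lra.
Qed.

Lemma bump_plateau e a b t : 0 < e -> a + 2 * e <= t <= b -> bump e a b t = 2 * e ^+ 2.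
Proof.
by move=> e0 /andP[h1 h2]; rewrite /bump bump_step_ge ?bump_step_le0 ?subr0//; lra.
Qed.

Lemma is_derive_bump e a b t :
  is_derive t 1 (bump e a b) (bump_hat e (t - a) - bump_hat e (t - b)).
Proof.
have d c := is_derive_comp_subr (is_derive_bump_step e (t - c)).
exact: is_deriveB (d a) (d b).
Qed.

Lemma continuous_bump e a b : continuous (bump e a b).
Proof.
move=> t; apply/differentiable_continuous/derivable1_diffP.
by case: (is_derive_bump e a b t).
Qed.

(** The bump is compared with [2 e^2] on its support [[a, b + 2e]] for the upper bound and on its
    plateau [[a + 2e, b]] for positivity. *)
Lemma integral_bump e a b : 0 < e -> a <= b -> exists beta,
  [/\ (\int[mu]_x (bump e a b x)%:E = beta%:E)%E, 0 <= beta,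
      beta <= 2 * e ^+ 2 * (b - a + 2 * e) &
      a + 2 * e < b -> 0 < beta].
Proof.
move=> e0 ab.
have mb : measurable_fun setT (bump e a b).
  by apply: continuous_measurable_fun; exact: continuous_bump.
have itv c d : c <= d -> (mu `[c, d]%classic = (d - c)%:E)%E.
  move=> cd; rewrite lebesgue_measure_itv/= lte_fin; case: ltP => // dc.
  by rewrite (@le_anti _ _ c d) ?subrr// cd dc.
have I0 : (0 <= \int[mu]_x (bump e a b x)%:E)%E.
  by apply: integral_ge0 => x _; rewrite lee_fin bump_ge0.
have I1 : (\int[mu]_x (bump e a b x)%:E <= (2 * e ^+ 2 * (b - a + 2 * e))%:E)%E.
  rewrite (@integral_support_itv _ a (b + 2 * e)); last by move=> x; exact: bump_eq0.
  apply: (@le_trans _ _ (\int[mu]_(x in `[a, (b + 2 * e)%R]) (2 * e ^+ 2)%:E)%E).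
    apply: ge0_le_integral => //.
    - by move=> x _; rewrite lee_fin bump_ge0.
    - by apply/measurable_EFinP; exact: measurable_funTS.
    - by move=> x _; rewrite lee_fin bump_le.
  rewrite integral_cst//= itv; last by lra.
  by rewrite -EFinM lee_fin le_eqVlt; apply/orP; left; apply/eqP; ring.
have If : (\int[mu]_x (bump e a b x)%:E)%E \is a fin_num.
  by rewrite ge0_fin_numE// (le_lt_trans I1)// ltry.
exists (fine (\int[mu]_x (bump e a b x)%:E)%E); rewrite fineK//; split => //.
- by rewrite fine_ge0.
- by rewrite -lee_fin fineK.
move=> abe; rewrite -lte_fin fineK//.
apply: (@lt_le_trans _ _ (2 * e ^+ 2 * (b - (a + 2 * e)))%:E).
  by rewrite lte_fin !mulr_gt0// subr_gt0.
apply: (@le_trans _ _ (\int[mu]_(x in `[(a + 2 * e)%R, b]) (2 * e ^+ 2)%:E)%E).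
  by rewrite integral_cst//= itv ?EFinM// ltW.
apply: (@le_trans _ _ (\int[mu]_(x in `[(a + 2 * e)%R, b]) (bump e a b x)%:E)%E).
  rewrite le_eqVlt; apply/orP; left; apply/eqP/eq_integral => x.
  by rewrite inE/= in_itv/= => h; rewrite bump_plateau.
apply: ge0_subset_integral => //; first exact/measurable_EFinP.
by move=> x _; rewrite lee_fin bump_ge0.
Qed.

End bump_integral.

(** * Products of one-variable functions as C^1 test functions *)

Section test_functions.
Context {R : realType}.

Lemma C1_on_ext (V : normedModType R) (f g : V -> R) : f =1 g ->
  C1_on setT f -> C1_on setT g.
Proof. by move=> /funext ->. Qed.

Lemma C1_on_cst (V : normedModType R) (k : R) : C1_on setT (fun _ : V => k).
Proof.
move=> p _; split=> [|v]; first exact: differentiable_cst.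
rewrite (_ : (fun q => 'D_v _ q) = cst 0); first exact: cvg_cst.
by apply/funext => q; exact: derive_cst.
Qed.

Lemma C1_onM (V : normedModType R) (f g : V -> R) :
  C1_on setT f -> C1_on setT g -> C1_on setT (fun p => f p * g p).
Proof.
move=> Cf Cg p _; have [df cf] := Cf p I; have [dg cg] := Cg p I.
split=> [|v]; first exact: differentiableM.
rewrite (_ : (fun q => 'D_v _ q) = (fun q => f q * 'D_v g q + g q * 'D_v f q)).
  apply: cvgD; apply: cvgM.
  - exact: differentiable_continuous.
  - exact: cg.
  - exact: differentiable_continuous.
  - exact: cf.
apply/funext => q; have [dfq _] := Cf q I; have [dgq _] := Cg q I.
by rewrite deriveM//; exact: diff_derivable.
Qed.

Lemma C1_on_prod (V : normedModType R) (J : Type) (s : seq J) (F : J -> V -> R) :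
  (forall j, C1_on setT (F j)) -> C1_on setT (fun p => \prod_(j <- s) F j p).
Proof.
move=> CF; elim: s => [|j s IH].
  by apply: C1_on_ext (C1_on_cst 1) => p; rewrite big_nil.
by apply: C1_on_ext (C1_onM (CF j) IH) => p; rewrite big_cons.
Qed.

Lemma is_derive_line (V : normedModType R) (f : V -> R) (p v : V) (t l : R) :
  is_derive (p + t *: v) v f l -> is_derive t 1 (fun s => f (p + s *: v)) l.
Proof.
move=> [df <-].
have E : (fun h : R => h^-1 *: (f (p + (h *: 1 + t) *: v) - f (p + t *: v))) =
         (fun h : R => h^-1 *: (f (h *: v + (p + t *: v)) - f (p + t *: v))).
  apply/funext => h; congr (_ *: (f _ - _)).
  by rewrite (_ : h%:A = h) ?scalerDl 1?addrCA// /GRing.scale /= mulr1.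
apply: DeriveDef; first by rewrite /derivable E.
by rewrite /derive E.
Qed.

Lemma derive_line_inv (V : normedModType R) (f : V -> R) (p v : V) (l : R) :
  is_derive (0 : R) (1 : R) (fun s => f (p + s *: v)) l -> is_derive p v f l.
Proof.
move=> [df <-].
have E : (fun h : R => h^-1 *: (f (p + (h *: 1 + (0 : R)) *: v) - f (p + (0 : R) *: v))) =
         (fun h : R => h^-1 *: (f (h *: v + p) - f p)).
  apply/funext => h; rewrite scale0r !addr0 (_ : h%:A = h); first by rewrite (addrC p).
  by rewrite /GRing.scale /= mulr1.
apply: DeriveDef; first by move: df; rewrite /derivable E.
by rewrite /derive E.
Qed.

Lemma is_derive_coord n (j : 'I_n) (h h' : R -> R) (y v : 'rV[R]_n) :
  (forall t : R, is_derive t 1 h (h' t)) ->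
  is_derive y v (fun z => h (z ord0 j)) (v ord0 j * h' (y ord0 j)).
Proof.
move=> dh; apply: derive_line_inv.
pose f (s : R) := y ord0 j + s * v ord0 j.
have df : is_derive (0 : R) (1 : R) f (v ord0 j).
  apply: (@is_derive_quadratic _ _ _ _ 0) => t.
  by rewrite /f (_ : _ - _ - _ = 0) ?normr0 ?mul0r//; ring.
have := @is_derive1_comp _ h f 0 _ _ (dh (f 0)) df.
rewrite mulrC {2}/f mul0r addr0; congr is_derive.
by apply/funext => s; rewrite /= !mxE.
Qed.

Lemma C1_on_coord n (j : 'I_n) (h h' : R -> R) :
  (forall t : R, is_derive t 1 h (h' t)) -> continuous h' ->
  C1_on setT (fun z : 'rV[R]_n => h (z ord0 j)).
Proof.
move=> dh ch y _; split=> [|v].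
  apply: differentiable_comp; first exact: differentiable_coord.
  by apply/derivable1_diffP; case: (dh (y ord0 j)).
rewrite (_ : (fun q => 'D_v _ q) = (fun q : 'rV[R]_n => v ord0 j * h' (q ord0 j))).
  apply: (@continuous_comp _ _ _ (fun q : 'rV[R]_n => q ord0 j) (fun t => v ord0 j * h' t)).
    exact: coord_continuous.
  by apply: cvgM; [exact: cvg_cst|exact: ch].
by apply/funext => q; have [_ ->] := is_derive_coord j q v dh.
Qed.

(** On a line parallel to the [i]-th axis all factors but the [i]-th are constant, which leaves a
    one-variable derivative. *)
Lemma is_derive_prod_coord n (i : 'I_n) (h h' : 'I_n -> R -> R) (y : 'rV[R]_n) :
  (forall j (t : R), is_derive t 1 (h j) (h' j t)) ->
  'D_(delta_mx ord0 i) (fun z : 'rV[R]_n => \prod_j h j (z ord0 j)) y =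
  \prod_j (if j == i then h' j else h j) (y ord0 j).
Proof.
move=> dh; set P := \prod_(j < n | j != i) h j (y ord0 j).
suff [_ ->] : is_derive y (delta_mx ord0 i)
    (fun z : 'rV[R]_n => \prod_j h j (z ord0 j)) (h' i (y ord0 i) * P).
  by rewrite [RHS](bigD1 i)//= eqxx; congr *%R; apply: eq_bigr => j /negPf ->.
apply: derive_line_inv.
rewrite (_ : (fun _ => _) = (fun s : R => h i (s + y ord0 i) * P)); last first.
  apply/funext => s; rewrite (bigD1 i)//= !mxE !eqxx mulr1 addrC; congr *%R.
  by apply: eq_bigr => j /negPf ji; rewrite !mxE ji andbF mulr0 addr0.
have d1 : is_derive (0 : R) (1 : R) (fun s => h i (s + y ord0 i)) (h' i (y ord0 i)).
  have d2 : is_derive (0 : R) (1 : R) (fun s : R => s + y ord0 i) 1.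
    by apply: is_derive_eq; rewrite addr0.
  have := @is_derive1_comp _ (h i) (fun s => s + y ord0 i) 0 _ _ (dh i (0 + y ord0 i)) d2.
  by rewrite mulr1 add0r.
by apply: is_derive_eq; rewrite scaler0 add0r /GRing.scale/= mulrC.
Qed.

End test_functions.

Section weighted_integrals.
Context d (T : measurableType d) (R : realType) (mu : {measure set T -> \bar R}).

Lemma integrable_weight (W : T -> R) (M : R) : measurable_fun setT W ->
  (forall t, 0 <= W t) -> (\int[mu]_t (W t)%:E = M%:E)%E -> mu.-integrable setT (EFin \o W).
Proof.
move=> mW W0 WM; apply/integrableP; split; first exact/measurable_EFinP.
by under eq_integral => t _ do rewrite /= ger0_norm//; rewrite WM ltry.
Qed.

(** [F] is [w]-close to [c] wherever the weight lives, so its weighted mean is too. Domination by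
    [(|c| + w) W] provides the integrability of [F W], with none assumed on [F]. *)
Lemma integral_weight_approx (F W : T -> R) (c w M : R) :
  measurable_fun setT F -> measurable_fun setT W -> (forall t, 0 <= W t) ->
  (\int[mu]_t (W t)%:E = M%:E)%E ->
  (forall t, W t != 0 -> `|F t - c| <= w) ->
  mu.-integrable setT (fun t => (F t * W t)%:E) /\
  `|\int[mu]_t (F t * W t) - c * M| <= w * M.
Proof.
move=> mF mW W0 WM Fc.
have iW := integrable_weight mW W0 WM.
have H t : `|F t * W t - c * W t| <= w * W t.
  rewrite -mulrBl normrM (ger0_norm (W0 t)).
  by have [->|Wt] := eqVneq (W t) 0; [rewrite !mulr0|rewrite ler_wpM2r// Fc].
have iZ k : mu.-integrable setT (EFin \o (fun t => k * W t)).
  by apply: eq_integrable (integrableZl measurableT k iW) => // t _; rewrite /= EFinM.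
have iFW : mu.-integrable setT (EFin \o (fun t => F t * W t)).
  apply: (le_integrable _ _ _ (iZ (`|c| + w))) => //.
    by apply/measurable_EFinP; exact: measurable_funM.
  move=> t _ /=; rewrite lee_fin; apply: le_trans (ler_norm _).
  rewrite mulrDl.
  have := H t; have := ler_normD (F t * W t - c * W t) (c * W t).
  by rewrite subrK (normrM c) (ger0_norm (W0 t)); lra.
split=> //.
have RM : \int[mu]_t W t = M by rewrite /Rintegral WM.
rewrite -RM -!RintegralZl// -RintegralB//.
apply: (le_trans (le_normr_Rintegral _ _)) => //.
  by apply: eq_integrable (integrableB measurableT iFW (iZ c)) => // t _; rewrite /= EFinB.
apply: le_Rintegral => //.
have : mu.-integrable setT (EFin \o (fun t => F t * W t - c * W t)).
  by apply: eq_integrable (integrableB measurableT iFW (iZ c)) => // t _; rewrite /= EFinB.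
by move/integrable_norm.
Qed.

Lemma ae_integral_weight_le (G W : T -> R) (C M : R) :
  measurable_fun setT G -> measurable_fun setT W -> (forall t, 0 <= W t) ->
  (\int[mu]_t (W t)%:E = M%:E)%E -> 0 <= C ->
  {ae mu, forall t, `|G t| <= C} ->
  (`|\int[mu]_t (G t * W t)%:E| <= (C * M)%:E)%E.
Proof.
move=> mG mW W0 WM C0 GC.
have mGW : measurable_fun setT (fun t => (G t * W t)%:E).
  by apply/measurable_EFinP; exact: measurable_funM.
apply: (le_trans (le_abse_integral _ measurableT mGW)).
rewrite EFinM -WM -ge0_integralZl//; last 2 first.
- exact/measurable_EFinP.
- by move=> t _; rewrite lee_fin.
apply: ae_ge0_le_integral => //.
- exact: measurableT_comp.
- by move=> t _; rewrite mule_ge0// lee_fin.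
- by apply/measurable_EFinP; exact: measurable_funM.
apply: filterS GC => t Gt _.
by rewrite -EFinM lee_fin normrM (ger0_norm (W0 t)) ler_wpM2r.
Qed.

End weighted_integrals.

(** * Increments along an axis by integration by parts *)

Section lipschitz_of_weak_gradient.
Context {R : realType}.
Local Notation RM := (measurableTypeR R).

(** Integration by parts against a thin tube around the segment from [x] to [x']. One side is a
    difference of two averages of [f] near the end points, about [M (f x - f x')]; the other is at
    most [C] times the mass of the tube, at most [(s + 2e) M]. Dividing by [M] leaves errors that
    vanish with the thickness. *)
Lemma weak_gradient_increment n (f : 'rV[R]_n -> R) (g : 'rV[R]_n -> 'rV[R]_n)
    (i : 'I_n) (C : R) (x : 'rV[R]_n) (s : R) :
  continuous f -> weak_gradient f g -> 0 <= C ->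
  {ae lebesgue_tuple n, forall t, `|g (rV_of_tuple t) ord0 i| <= C} -> 0 < s ->
  `|f (x + s *: delta_mx ord0 i) - f x| <= C * s.
Proof.
move=> cf [mf wg] C0 gC s0; have [mg wgi] := wg i.
set x' := x + _.
apply/ler_addgt0Pl => w w0.
(* The final error is [2 C e + 2 w'], and [e <= w']. *)
pose w' := w / (2 * C + 2).
have w'0 : 0 < w' by rewrite divr_gt0//; lra.
have near_f (z : 'rV[R]_n) :
    exists2 d, 0 < d & forall y, `|z - y| < d -> `|f y - f z| <= w'.
  have /cvgrPdist_le/(_ w' w'0)/nbhs_ballP[d d0 H] := cf z.
  by exists d => // y zy; rewrite distrC; apply: H; rewrite -ball_normE.
have [d d0 fd] := near_f x.
have [d' d'0 fd'] := near_f x'.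
(* The weights live in boxes with sides at most [6 * e] issuing from [x] or [x'], hence within
   distance [d] or [d']. *)
pose e := Num.min w' (Num.min d d') / 8.
have e0 : 0 < e by rewrite divr_gt0// !lt_min w'0 d0 d'0.
have ed : 8 * e <= d by rewrite /e mulrC divfK// !ge_min lexx !orbT.
have ed' : 8 * e <= d' by rewrite /e mulrC divfK// !ge_min lexx !orbT.
have ew : 8 * e <= w' by rewrite /e mulrC divfK// !ge_min lexx.
pose a j := x ord0 j.
(* Length [s] along the axis. Across it, width [4 * e] exceeds the [2 * e] that makes [beta j]
   positive, so that [M] can be divided out. *)
pose b j := x ord0 j + (if j == i then s else 4 * e).
have ab j : a j <= b j by rewrite /b /a lerDl; case: ifP => _; lra.
pose h j := bump e (a j) (b j).
pose hat c (t : R) := bump_hat e (t - c).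
have /choice[beta Hb] : forall j, exists betaj,
    [/\ (\int[@lebesgue_measure R]_t (h j t)%:E = betaj%:E)%E, 0 <= betaj,
      betaj <= 2 * e ^+ 2 * (b j - a j + 2 * e) & a j + 2 * e < b j -> 0 < betaj].
  by move=> j; exact: integral_bump.
pose B := \prod_(j < n | j != i) beta j.
(* The mass of each weight [W c]: a tent in the direction [i] times the transversal bumps. *)
pose M := 2 * e ^+ 2 * B.
have B0 : 0 < B.
  apply: prodr_gt0 => j ji; have [_ _ _] := Hb j; apply.
  by rewrite /a /b (negPf ji) ltrD2l; lra.
have M0 : 0 < M by rewrite /M mulr_gt0// mulr_gt0// exprn_gt0.
pose Fa c j : R -> R := if j == i then hat c else h j.
pose W c (t : n.-tuple RM) : R := \prod_j Fa c j (tnth t j).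
pose Phi (t : n.-tuple RM) : R := \prod_j h j (tnth t j).
have h_ge0 j t : 0 <= h j t by exact: bump_ge0.
have Fa_ge0 c j t : 0 <= Fa c j t.
  by rewrite /Fa; case: ifP => _ //; exact: bump_hat_ge0.
have mh j : measurable_fun setT (h j).
  by apply: continuous_measurable_fun; exact: continuous_bump.
have chat c : continuous (hat c).
  move=> t; apply: (@continuous_comp _ _ _ (fun s : R => s - c) (bump_hat e)).
    by apply: cvgB; [exact: cvg_id|exact: cvg_cst].
  exact: continuous_bump_hat.
have mFa c j : measurable_fun setT (Fa c j).
  by rewrite /Fa; case: ifP => _ //; exact: continuous_measurable_fun.
have mW c : measurable_fun setT (W c) by exact: measurable_prod_tnth.
have mPhi : measurable_fun setT Phi by exact: measurable_prod_tnth.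
have W_ge0 c t : 0 <= W c t by rewrite /W prodr_ge0.
have Phi_ge0 t : 0 <= Phi t by rewrite /Phi prodr_ge0.
have IW c : (\int[lebesgue_tuple n]_t (W c t)%:E = M%:E)%E.
  pose mass j := if j == i then 2 * e ^+ 2 else beta j.
  rewrite (@integral_lebesgue_tuple_prod _ _ _ mass) /mass//.
    congr EFin; rewrite (bigD1 i)//= eqxx; congr *%R.
    by apply: eq_bigr => j /negPf ->.
  move=> j; rewrite /Fa; case: ifP => _; first exact: integral_bump_hat.
  by have [] := Hb j.
have IPhi : (\int[lebesgue_tuple n]_t (Phi t)%:E = (beta i * B)%:E)%E.
  rewrite (@integral_lebesgue_tuple_prod _ _ _ beta)//.
    by rewrite (bigD1 i).
  by move=> j; have [] := Hb j.
have IPhi_le : beta i * B <= (s + 2 * e) * M.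
  have bai : b i - a i = s by rewrite /b /a eqxx addrAC subrr add0r.
  have [_ _ + _] := Hb i; rewrite bai /M.
  move=> /(ler_wpM2r (ltW B0)) /le_trans; apply.
  by rewrite le_eqVlt; apply/orP; left; apply/eqP; ring.
(* The derivative of [phi] along the i-th coordinate is [W (a i) - W (b i)], where
   [W (a i)] and [W (b i)] have the same mass and are concentrated near [x] and [x']. *)
pose phi (y : 'rV[R]_n) : R := \prod_j h j (y ord0 j).
have hder j (t : R) := is_derive_bump e (a j) (b j) t.
have phiE t : phi (rV_of_tuple t) = Phi t.
  by apply: eq_bigr => j _; rewrite mxE.
have C1phi : C1_on setT phi.
  apply: (@C1_on_prod _ _ _ _ (fun j (y : 'rV[R]_n) => h j (y ord0 j))) => j.
  apply: (@C1_on_coord _ _ j (h j) (fun t => hat (a j) t - hat (b j) t) (hder j)).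
  by move=> t; apply: cvgB; exact: chat.
have dphi t : 'D_(delta_mx ord0 i) phi (rV_of_tuple t) = W (a i) t - W (b i) t.
  pose h' j t := hat (a j) t - hat (b j) t.
  rewrite (@is_derive_prod_coord _ _ i h h' _ hder) /h' /W.
  rewrite !(bigD1 (P := xpredT) i)//= /Fa eqxx mxE mulrBl.
  by congr (_ * _ - _ * _); apply: eq_bigr => j /negPf ji; rewrite ji mxE.
have supp : compact (closure [set y | phi y != 0]).
  pose K := [set y : 'rV[R]_n | forall j, `[a j, b j + 2 * e]%classic (y ord0 j)].
  have cK : compact K.
    apply: (@rV_compact R n (fun j => `[a j, b j + 2 * e]%classic)) => j.
    exact: segment_compact.
  apply: (subclosed_compact _ cK); first exact: closed_closure.
  have clK : closed K by apply: compact_closed cK; exact: norm_hausdorff.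
  rewrite [X in _ `<=` X]((closure_id K).1 clK).
  apply: closureS => y /= py j; rewrite /= in_itv/=.
  apply: contraNT py => hj; rewrite /phi (bigD1 j)//= /h bump_eq0 ?mul0r//.
have := wgi phi C1phi supp.
have small c t j : W c t != 0 -> if j == i then c <= tnth t i <= c + 2 * e
    else x ord0 j <= tnth t j <= x ord0 j + 6 * e.
  move=> Wt; have : Fa c j (tnth t j) != 0.
    by apply: contraNneq Wt => Z; rewrite /W (bigD1 j)//= Z mul0r.
  rewrite /Fa; case: ifPn => [/eqP -> | ji].
    apply: contraNT; rewrite negb_and -!ltNge => hh; apply/eqP/bump_hat_eq0 => //.
    by case/orP: hh => hh; [left|right]; lra.
  apply: contraNT => hh; apply/eqP/bump_eq0 => //.
  apply: contraNN hh; rewrite /a /b (negPf ji) => /andP[-> /le_trans]; apply.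
  lra.
have approx (c : R) (z : 'rV[R]_n) (d1 : R) : 8 * e <= d1 -> (z ord0 i = c) ->
    (forall j, j != i -> z ord0 j = x ord0 j) ->
    (forall y, `|z - y| < d1 -> `|f y - f z| <= w') ->
    (lebesgue_tuple n).-integrable setT (fun t => (f (rV_of_tuple t) * W c t)%:E) /\
    `|\int[lebesgue_tuple n]_t (f (rV_of_tuple t) * W c t) - f z * M| <= w' * M.
  move=> ed1 zi zj fz; apply: integral_weight_approx => // t Wt.
  apply: fz; apply: (@le_lt_trans _ _ (6 * e)); last by lra.
  apply: rV_norm_le => [|j]; first by lra.
  rewrite !mxE; have := small c t j Wt; case: ifPn => [/eqP -> | ji] /andP[h1 h2].
    by rewrite zi ler_norml; lra.
  by rewrite zj// ler_norml; lra.
have [ia ha] :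
    (lebesgue_tuple n).-integrable setT (fun t => (f (rV_of_tuple t) * W (a i) t)%:E) /\
    `|\int[lebesgue_tuple n]_t (f (rV_of_tuple t) * W (a i) t) - f x * M| <= w' * M.
  exact: approx fd.
have [ib hb] :
    (lebesgue_tuple n).-integrable setT (fun t => (f (rV_of_tuple t) * W (b i) t)%:E) /\
    `|\int[lebesgue_tuple n]_t (f (rV_of_tuple t) * W (b i) t) - f x' * M| <= w' * M.
  apply: approx fd' => //; first by rewrite /x' !mxE !eqxx /b eqxx mulr1.
  by move=> j ji; rewrite /x' !mxE (negPf ji) andbF mulr0 addr0.
have -> : (\int[lebesgue_tuple n]_t
      (f (rV_of_tuple t) * 'D_(delta_mx ord0 i) phi (rV_of_tuple t))%:E =
   (\int[lebesgue_tuple n]_t (f (rV_of_tuple t) * W (a i) t) -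
    \int[lebesgue_tuple n]_t (f (rV_of_tuple t) * W (b i) t))%:E)%E.
  rewrite -RintegralB// /Rintegral fineK; last first.
    apply: integrable_fin_num => //.
    by apply: eq_integrable (integrableB measurableT ia ib) => // t _; rewrite /= EFinB.
  by apply: eq_integral => t _; rewrite dphi mulrBr.
have hg : (`|\int[lebesgue_tuple n]_t
      (g (rV_of_tuple t) ord0 i * phi (rV_of_tuple t))%:E| <= (C * (beta i * B))%:E)%E.
  under eq_integral do rewrite phiE.
  exact: ae_integral_weight_le.
move=> E; have {}E : (\int[lebesgue_tuple n]_t
      (g (rV_of_tuple t) ord0 i * phi (rV_of_tuple t))%:E =
  (- (\int[lebesgue_tuple n]_t (f (rV_of_tuple t) * W (a i) t) -
    \int[lebesgue_tuple n]_t (f (rV_of_tuple t) * W (b i) t)))%:E)%E.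
  by rewrite EFinN E oppeK.
move: hg; rewrite E lee_fin normrN => hg.
set Ja := \int[_]_t _ in ha hg *; set Jb := \int[_]_t _ in hb hg *.
have main : `|f x' - f x| * M <= (C * (s + 2 * e) + 2 * w') * M.
  clear - ha hb hg IPhi_le M0 C0; clearbody Ja Jb x'; clear W.
  rewrite -[X in _ * X <= _](gtr0_norm M0) -normrM.
  have : C * (beta i * B) <= C * ((s + 2 * e) * M) by rewrite ler_wpM2l.
  move: ha hb hg; rewrite !ler_norml => /andP[h1 h2] /andP[h3 h4] /andP[h5 h6] h7.
  apply/andP; split; lra.
rewrite ler_pM2r// in main; apply: (le_trans main).
clear - C0 w0 ew e0.
have : w' * (2 * C + 2) = w by rewrite /w' divfK//; lra.
have : C * e <= C * w' by rewrite ler_wpM2l//; lra.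
lra.
Qed.

End lipschitz_of_weak_gradient.

(** * From almost everywhere bounds to pointwise bounds *)

Section W1oo_lipschitz.
Context {R : realType}.
Local Notation RM := (measurableTypeR R).

(** Otherwise a product of bumps supported within distance [d] of [x] would vanish almost
    everywhere, while its integral is a product of positive numbers. With [e = d / 4] each factor
    lives on [[x_j - e, x_j + 4e]]. *)
Lemma lebesgue_tuple_ae_dense n (P : n.-tuple RM -> Prop) (x : 'rV[R]_n) (d : R) :
  0 < d -> {ae lebesgue_tuple n, forall t, P t} ->
  exists2 t, P t & `|rV_of_tuple t - x| <= d.
Proof.
move=> d0 aeP; apply: contrapT => noP.
pose e := d / 4.
have e0 : 0 < e by rewrite divr_gt0.
have de : d = 4 * e by rewrite /e mulrC divfK.
pose h j := bump e (x ord0 j - e) (x ord0 j + 2 * e).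
have /choice[beta Hb] : forall j, exists betaj,
    (\int[@lebesgue_measure R]_t (h j t)%:E = betaj%:E)%E /\ 0 < betaj.
  move=> j.
  have xe : x ord0 j - e <= x ord0 j + 2 * e by lra.
  have [b [h1 h2 h3 h4]] := @integral_bump R e _ _ e0 xe.
  by exists b; split => //; apply: h4; lra.
have h_ge0 j t : 0 <= h j t by apply: bump_ge0 => //; lra.
have mh j : measurable_fun setT (h j).
  by apply: continuous_measurable_fun; exact: continuous_bump.
have I1 := integral_lebesgue_tuple_prod mh h_ge0 (fun j => (Hb j).1).
have I2 : (\int[lebesgue_tuple n]_t (\prod_j h j (tnth t j))%:E = 0)%E.
  rewrite (ae_eq_integral (fun=> 0%E)) ?integral0//; last 2 first.
  - by apply/measurable_EFinP; exact: measurable_prod_tnth.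
  - apply: filterS aeP => t Pt _; congr EFin; apply/eqP; apply: contrapT => /negP ht.
    apply: noP; exists t => //.
    apply: rV_norm_le => [|j]; first exact: ltW.
    have : h j (tnth t j) != 0.
      by apply: contraNneq ht => Z; rewrite (bigD1 j)//= Z mul0r.
    rewrite !mxE; apply: contraNT => hh; apply/eqP/bump_eq0 => //; first by lra.
    by apply: contraNN hh => /andP[h1 h2]; rewrite ler_norml; lra.
have : 0 < \prod_j beta j by apply: prodr_gt0 => j _; exact: (Hb j).2.
by move: I1; rewrite I2 => -[<-]; rewrite ltxx.
Qed.

(** The [L^oo] norm is an essential supremum only on a space of positive measure and is 0 otherwise;
    [Linfty_norm_ae] has to exclude the second case. *)
Lemma lebesgue_tuple_setT_gt0 n : (0 < lebesgue_tuple n [set: n.-tuple RM])%E.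
Proof.
rewrite lt_neqAle measure_ge0 andbT eq_sym; apply/negP => /eqP T0.
have [] := @lebesgue_tuple_ae_dense n (fun=> False) 0 1 ltr01; last by [].
by exists setT; split => //.
Qed.

Lemma Linfty_norm_ae n (h : 'rV[R]_n -> R) (M : R) : (Linfty_norm h <= M%:E)%E ->
  {ae lebesgue_tuple n, forall t, `|h (rV_of_tuple t)| <= M}.
Proof.
rewrite /Linfty_norm unlock lebesgue_tuple_setT_gt0 => /ess_supP.
by apply: filterS => t /=.
Qed.

(** The coordinates of [y] are replaced by those of [x] one at a time; the [n] replacements give the
    factor [n]. *)
Lemma coord_lipschitz n (f : 'rV[R]_n -> R) (C : R) :
  (forall x i s, `|f (x + s *: delta_mx ord0 i) - f x| <= C * `|s|) ->
  forall x y, `|f x - f y| <= n%:R * C * `|x - y|.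
Proof.
move=> H x y.
have C0 (i : 'I_n) : 0 <= C.
  by have := H 0 i 1; rewrite normr1 mulr1; exact: le_trans.
pose z k : 'rV[R]_n := \row_j (if (j < k)%N then x ord0 j else y ord0 j).
have step k : (k <= n)%N -> `|f (z k) - f y| <= k%:R * C * `|x - y|.
  elim: k => [_|k IH kn].
    rewrite (_ : z 0%N = y) ?subrr ?normr0 ?mul0r//.
    by apply/rowP => j; rewrite mxE.
  pose i := Ordinal kn.
  have -> : z k.+1 = z k + (x ord0 i - y ord0 i) *: delta_mx ord0 i.
    apply/rowP => j; rewrite !mxE eqxx/=.
    have [->|ji] := eqVneq j i; first by rewrite /= ltnn ltnS leqnn mulr1 addrC subrK.
    rewrite mulr0 addr0 ltnS leq_eqVlt.
    rewrite (_ : (j == k :> nat) = false)//.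
    by apply: contraNF ji => /eqP jk; apply/eqP/val_inj.
  apply: (le_trans (ler_distD (f (z k)) _ _)).
  rewrite -natr1 !mulrDl mul1r addrC lerD ?IH// 1?ltnW//.
  apply: (le_trans (H _ _ _)); rewrite ler_wpM2l ?(C0 i)//.
  by have := rV_coord_le (x - y) i; rewrite !mxE.
have := step n (leqnn n); congr (`|f _ - _| <= _).
by apply/rowP => j; rewrite mxE ltn_ord.
Qed.

(** The strict inequality makes an actual weak gradient available from the infimum. Continuity turns
    the almost everywhere bound on [f] into a pointwise one. *)
Lemma W1oo_norm_lipschitz n (f : 'rV[R]_n -> R) (M : R) :
  continuous f -> (W1oo_norm f < M%:E)%E ->
  (forall x, `|f x| <= M) /\ (forall x y, `|f x - f y| <= n%:R * M * `|x - y|).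
Proof.
move=> cf /ereal_inf_lt[_ [g wg <-]] fgM.
have Lge0 (h : 'rV[R]_n -> R) : (0 <= Linfty_norm h)%E by exact: Lnorm_ge0.
have fM : (Linfty_norm f <= M%:E)%E.
  by apply/ltW/(le_lt_trans _ fgM); rewrite leeDl.
have gM : (Linfty_norm (@euclidean_norm R n \o g) <= M%:E)%E.
  by apply/ltW/(le_lt_trans _ fgM); rewrite leeDr.
have M0 : 0 <= M by rewrite -lee_fin (le_trans (Lge0 f)).
split.
  move=> x; apply/ler_addgt0Pl => w w0.
  have /cvgrPdist_le/(_ w w0)/nbhs_ballP[d d0 H] := cf x.
  have d2 : 0 < d / 2 by rewrite divr_gt0.
  have [t ft tx] := lebesgue_tuple_ae_dense x d2 (Linfty_norm_ae fM).
  have : `|f x - f (rV_of_tuple t)| <= w.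
    apply: H; rewrite -ball_normE/= distrC (le_lt_trans tx)//.
    by rewrite ltr_pdivrMr// ltr_pMr// ltr1n.
  have := ler_normD (f x - f (rV_of_tuple t)) (f (rV_of_tuple t)).
  rewrite subrK; lra.
apply: coord_lipschitz => x i s.
have gi : {ae lebesgue_tuple n, forall t, `|g (rV_of_tuple t) ord0 i| <= M}.
  apply: filterS (Linfty_norm_ae gM) => t /=; apply: le_trans.
  rewrite /euclidean_norm [leRHS]ger0_norm ?sqrtr_ge0// -sqrtr_sqr ler_wsqrtr//.
  by rewrite (bigD1 i)//= lerDl sumr_ge0// => j _; exact: sqr_ge0.
(* A negative increment is a positive one started from the other end point. *)
have [s0|s0|<-] := ltgtP 0 s; last by rewrite scale0r addr0 subrr !normr0 mulr0.
  by rewrite (gtr0_norm s0); exact: weak_gradient_increment wg M0 gi s0.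
have s0' : 0 < - s by rewrite oppr_gt0.
rewrite distrC (ltr0_norm s0).
have := weak_gradient_increment (x + s *: delta_mx ord0 i) cf wg M0 gi s0'.
by rewrite scaleNr addrK.
Qed.

End W1oo_lipschitz.

(** * The monotone scheme *)

Section scheme.
Context {R : realType} {n : nat}.
Local Notation rV := 'rV[R]_n.
Local Notation e_ i := (delta_mx ord0 i : rV).

Definition difference_quotient (h : R) (u : rV -> R) (x : rV) : rV :=
  \row_i ((u (x + h *: e_ i) - u (x - h *: e_ i)) / (2 * h)).

Definition lax_friedrichs (h t : R) (H : rV -> R) (u : rV -> R) (x : rV) : R :=
  (2 * n%:R)^-1 * \sum_i (u (x + h *: e_ i) + u (x - h *: e_ i)) +
  t * H (difference_quotient h u x).

(* Taking the maximum with [u x] is consistent with [u_t = H(Du)] because [H >= 0]. *)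
Definition scheme (h t : R) (H : rV -> R) (u : rV -> R) (x : rV) : R :=
  Num.max (u x) (lax_friedrichs h t H u x).

Variables (L t : R) (H : rV -> R).
Hypothesis n_gt0 : (0 < n)%N.
Hypothesis L_gt0 : 0 < L.
Hypothesis t_gt0 : 0 < t.
Hypothesis H_lip : forall p q, `|H p - H q| <= L * `|p - q|.
Hypothesis H0 : H 0 = 0.
(* The smallest space step for which the Lax-Friedrichs operator is monotone. *)
Let h := n%:R * L * t.
Local Notation LF := (lax_friedrichs h t H).
Local Notation G := (scheme h t H).

Let nR_gt0 : 0 < n%:R :> R. Proof. by rewrite ltr0n. Qed.
Let h_gt0 : 0 < h. Proof. by rewrite !mulr_gt0. Qed.

Lemma lax_friedrichs_cst (c : R) x : LF (cst c) x = c.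
Proof.
rewrite /lax_friedrichs (_ : difference_quotient _ _ _ = 0); last first.
  by apply/rowP => i; rewrite !mxE subrr mul0r.
rewrite H0 mulr0 addr0 /= sumr_const card_ord -mulr_natl -mulr2n -[c *+ 2]mulr_natl.
by field; rewrite gt_eqF.
Qed.

Lemma lax_friedrichs_addr (c : R) u x : LF (fun y => u y + c) x = LF u x + c.
Proof.
rewrite /lax_friedrichs (_ : difference_quotient _ _ _ = difference_quotient h u x); last first.
  by apply/rowP => i; rewrite !mxE; congr (_ / _); ring.
rewrite -addrA [t * _ + c]addrC addrA; congr (_ + _).
under eq_bigr do rewrite addrACA.
rewrite big_split/= sumr_const card_ord mulrDr; congr (_ + _).
by rewrite -mulr_natl -mulr2n -[c *+ 2]mulr_natl; field; rewrite gt_eqF.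
Qed.

(** If the neighbouring values rise by [D] in total, the difference quotient moves by at most
    [D / (2h)] in the maximum norm, so the term [t * H] falls by at most [t L D / (2h) = D / (2n)]:
    exactly what the average gains. *)
Lemma lax_friedrichs_le u v x :
  (forall i, u (x + h *: e_ i) <= v (x + h *: e_ i)) ->
  (forall i, u (x - h *: e_ i) <= v (x - h *: e_ i)) -> LF u x <= LF v x.
Proof.
move=> uvp uvm; rewrite /lax_friedrichs.
set su := \sum_i _; set sv := \sum_i _.
set pu := difference_quotient _ u _; set pv := difference_quotient _ v _.
have term_ge0 i : 0 <= v (x + h *: e_ i) + v (x - h *: e_ i)
    - (u (x + h *: e_ i) + u (x - h *: e_ i)).
  by have := uvp i; have := uvm i; lra.
have D0 : 0 <= sv - su by rewrite /sv /su -sumrB sumr_ge0.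
have dp : `|pu - pv| <= (2 * h)^-1 * (sv - su).
  apply: rV_norm_le => [|i]; first by rewrite mulr_ge0// invr_ge0 ltW// mulr_gt0.
  rewrite !mxE -mulrBl normrM mulrC gtr0_norm ?invr_gt0 ?mulr_gt0//.
  have h2 : 0 <= (2 * h)^-1 by rewrite invr_ge0 ltW// mulr_gt0.
  apply: (ler_wpM2l h2).
  apply: (@le_trans _ _ (v (x + h *: e_ i) + v (x - h *: e_ i)
      - (u (x + h *: e_ i) + u (x - h *: e_ i)))).
    by rewrite ler_norml; have := uvp i; have := uvm i; lra.
  by rewrite /sv /su -sumrB (bigD1 i)//= lerDl sumr_ge0.
have : t * (H pu - H pv) <= (2 * n%:R)^-1 * (sv - su).
  apply: (@le_trans _ _ (t * (L * ((2 * h)^-1 * (sv - su))))).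
    apply: (ler_wpM2l (ltW t_gt0)); apply: (le_trans (ler_norm _)).
    by apply: (le_trans (H_lip _ _)); rewrite ler_wpM2l// ltW.
  rewrite /h le_eqVlt; apply/orP; left; apply/eqP; field.
  by rewrite !gt_eqF.
rewrite !mulrBr; lra.
Qed.

Lemma scheme_ge u x : u x <= G u x.
Proof. by rewrite /scheme le_max lexx. Qed.

(** Monotonicity and commutation with constants, localized to the stencil of [x], as comparison on
    cones requires. *)
Lemma scheme_le_addr (c : R) u v x : u x <= v x + c ->
  (forall i, u (x + h *: e_ i) <= v (x + h *: e_ i) + c) ->
  (forall i, u (x - h *: e_ i) <= v (x - h *: e_ i) + c) -> G u x <= G v x + c.
Proof.
move=> uv uvp uvm; rewrite /scheme ge_max; apply/andP; split.
  by apply: (le_trans uv); rewrite lerD2r le_max lexx.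
apply: (@le_trans _ _ (LF v x + c)); last by rewrite lerD2r le_max lexx orbT.
by rewrite -lax_friedrichs_addr lax_friedrichs_le.
Qed.

Lemma scheme_le_cst (c : R) u x : (forall y, u y <= c) -> G u x <= c.
Proof.
move=> uc; rewrite /scheme ge_max uc -[leRHS](lax_friedrichs_cst c x).
by rewrite lax_friedrichs_le.
Qed.

Lemma scheme_shift u z x : G (fun y => u (y + z)) x = G u (x + z).
Proof.
rewrite /scheme /lax_friedrichs; congr (Num.max _ (_ * _ + _ * H _)).
  by apply: eq_bigr => i _; rewrite ![_ + z]addrAC.
by apply/rowP => i; rewrite !mxE ![_ + z]addrAC.
Qed.

(** [u] is compared with its translate by [y - x], from which it differs by at most [K |x - y|].
    Neither [H] nor [L] affects the constant. *)
Lemma scheme_lipschitz (K : R) u : (forall x y, `|u x - u y| <= K * `|x - y|) ->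
  forall x y, `|G u x - G u y| <= K * `|x - y|.
Proof.
move=> uK.
suff H1 x y : G u x <= G u y + K * `|x - y|.
  by move=> x y; rewrite ler_norml; have := H1 x y; have := H1 y x; rewrite (distrC y); lra.
rewrite -[in G u y](subrKC x y) -scheme_shift.
have uu z : u z <= u (z + (y - x)) + K * `|x - y|.
  have := uK z (z + (y - x)); rewrite (_ : z - (z + _) = x - y); last first.
    by rewrite opprD opprB addrA subrr add0r.
  by rewrite ler_norml; lra.
by apply: scheme_le_addr.
Qed.

(** Averaging costs at most [K h = t n L K], since [h] is proportional to [t], and the Hamiltonian
    at most [t L K]. *)
Lemma scheme_increment (K : R) u x : 0 <= K ->
  (forall x y, `|u x - u y| <= K * `|x - y|) ->
  G u x - u x <= t * ((n%:R + 1) * L * K).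
Proof.
move=> K0 uK.
have he i : `|h *: e_ i| <= h.
  by apply: (le_trans (rV_norm_scale_delta_le _ _)); rewrite gtr0_norm.
have up i : `|u (x + h *: e_ i) - u x| <= K * h.
  by apply: (le_trans (uK _ _)); rewrite addrAC subrr add0r ler_wpM2l.
have um i : `|u (x - h *: e_ i) - u x| <= K * h.
  by apply: (le_trans (uK _ _)); rewrite addrAC subrr add0r normrN ler_wpM2l.
rewrite lerBlDr /scheme ge_max lerDr; apply/andP; split.
  by rewrite !mulr_ge0// ltW// addr_gt0.
have Hp : H (difference_quotient h u x) <= L * K.
  apply: (le_trans (ler_norm _)); rewrite -[X in `|X|]subr0 -H0.
  apply: (le_trans (H_lip _ _)); rewrite subr0; apply: (ler_wpM2l (ltW L_gt0)).
  apply: rV_norm_le => // i; have h2 : 0 < 2 * h by rewrite mulr_gt0.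
  rewrite mxE normrM normfV (gtr0_norm h2) ler_pdivrMr//.
  by have := up i; have := um i; rewrite !ler_norml; lra.
have S : (2 * n%:R)^-1 * (\sum_i (u (x + h *: e_ i) + u (x - h *: e_ i))) <= u x + K * h.
  rewrite mulrC ler_pdivrMr ?mulr_gt0//.
  apply: (@le_trans _ _ (\sum_(i < n) (2 * (u x + K * h)))).
    by apply: ler_sum => i _; have := up i; have := um i; rewrite !ler_norml; lra.
  by rewrite sumr_const card_ord -mulr_natr le_eqVlt; apply/orP; left; apply/eqP; ring.
have : t * H (difference_quotient h u x) <= t * (L * K) by rewrite ler_wpM2l// ltW.
have : K * h = t * (n%:R * L * K) by rewrite /h; ring.
rewrite /lax_friedrichs; lra.
Qed.

End scheme.

(** * Iterates of the scheme with a source term *)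

Section recursion.
Context {R : realType} {n : nat}.
Local Notation rV := 'rV[R]_n.
Local Notation e_ i := (delta_mx ord0 i : rV).
Variables (L t : R) (H : rV -> R).
Hypothesis n_gt0 : (0 < n)%N.
Hypothesis L_gt0 : 0 < L.
Hypothesis t_gt0 : 0 < t.
Hypothesis H_lip : forall p q, `|H p - H q| <= L * `|p - q|.
Hypothesis H0 : H 0 = 0.
Let h := n%:R * L * t.
Local Notation G := (scheme h t H).

Let h_gt0 : 0 < h. Proof. by rewrite !mulr_gt0// ltr0n. Qed.

Section facts.
Variables (u a : nat -> rV -> R).
Hypothesis rec : forall k x, u k.+1 x = G (u k) x + t * a k x.

Lemma recursion_lipschitz (K Ka : R) k :
  (forall x y, `|u 0%N x - u 0%N y| <= K * `|x - y|) ->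
  (forall k x y, `|a k x - a k y| <= Ka * `|x - y|) ->
  forall x y, `|u k x - u k y| <= (K + k%:R * t * Ka) * `|x - y|.
Proof.
move=> uK aK; elim: k => [|k IH] x y; first by rewrite !mul0r addr0.
rewrite !rec opprD addrACA -mulrBr; apply: (le_trans (ler_normD _ _)).
have h1 := scheme_lipschitz n_gt0 L_gt0 t_gt0 H_lip IH x y.
have h2 : `|t * (a k x - a k y)| <= t * (Ka * `|x - y|).
  by rewrite normrM gtr0_norm// ler_wpM2l ?aK// ltW.
apply: (le_trans (lerD h1 h2)); rewrite le_eqVlt; apply/orP; left; apply/eqP.
rewrite -natr1; ring.
Qed.

Lemma recursion_increment (K M : R) k x : 0 <= K ->
  (forall x y, `|u k x - u k y| <= K * `|x - y|) -> `|a k x| <= M ->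
  `|u k.+1 x - u k x| <= t * ((n%:R + 1) * L * K + M).
Proof.
move=> K0 uK aM; rewrite rec.
have h1 := scheme_increment n_gt0 L_gt0 t_gt0 H_lip H0 x K0 uK.
have h2 := scheme_ge L t H (u k) x; rewrite -/h in h1 h2.
have h3 : `|t * a k x| <= t * M by rewrite normrM gtr0_norm// ler_wpM2l// ltW.
have h4 : 0 <= t * ((n%:R + 1) * L * K).
  by rewrite !mulr_ge0// ?addr_ge0// ltW.
by move: h3; rewrite mulrDr !ler_norml; lra.
Qed.

(* Finite speed of propagation: [u k x] only depends on the data in the ball of
   radius [k%:R * h] around [x]. *)
Lemma recursion_local (e rho : R) (x y : rV) k :
  (forall z, `|z| <= rho -> u 0%N (x + z) <= u 0%N (y + z) + e) ->
  (forall k z, `|z| <= rho -> a k (x + z) <= a k (y + z) + e) ->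
  forall z, `|z| + k%:R * h <= rho -> u k (x + z) <= u k (y + z) + e * (1 + k%:R * t).
Proof.
move=> u0e ae; elim: k => [|k IH] z zr.
  by rewrite mul0r addr0 mulr1 u0e//; move: zr; rewrite mul0r addr0.
have zr' : `|z| + h + k%:R * h <= rho by move: zr; rewrite -natr1; lra.
rewrite !rec.
have h1 : G (u k) (x + z) <= G (u k) (y + z) + e * (1 + k%:R * t).
  rewrite (addrC x) (addrC y) -(scheme_shift _ _ _ (u k) x) -(scheme_shift _ _ _ (u k) y).
  have zh (s : R) i : `|s| = h -> `|z + s *: e_ i| + k%:R * h <= rho.
    move=> sh; apply: le_trans zr'; rewrite lerD2r (le_trans (ler_normD _ _))//.
    by rewrite lerD2l -sh rV_norm_scale_delta_le.
  apply: scheme_le_addr => // [|i|i].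
  - by rewrite !(addrC z) IH//; apply: le_trans zr'; rewrite lerD2r lerDl ltW.
  - by rewrite !(addrC (z + _)) IH//; apply: zh; rewrite gtr0_norm.
  - rewrite -scaleNr !(addrC (z + _)) IH//; apply: zh; rewrite normrN gtr0_norm//.
have h2 : t * a k (x + z) <= t * (a k (y + z) + e).
  apply: (ler_wpM2l (ltW t_gt0)); apply: ae; apply: le_trans zr'.
  by rewrite -addrA lerDl addr_ge0// ?mulr_ge0// ltW.
rewrite -natr1; lra.
Qed.

Let cone_stencil (m j : nat) (x x0 : rV) (s : R) i : (j < m)%N -> `|s| = h ->
  `|x - x0| <= (m - j.+1)%:R * h -> `|x + s *: e_ i - x0| <= (m - j)%:R * h.
Proof.
move=> jm sh xm; rewrite addrAC (le_trans (ler_normD _ _))//.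
have -> : (m - j)%:R = (m - j.+1)%:R + 1 :> R by rewrite natr1 subnSK.
rewrite mulrDl mul1r lerD// (le_trans (rV_norm_scale_delta_le _ _))//.
by rewrite sh.
Qed.

(** The admissible radius shrinks by one stencil width [h] per step, so every value used at step [j]
    is already controlled: a comparison on the base alone reaches the apex. *)
Lemma recursion_cone_le (psi : nat -> rV -> R) (x0 : rV) (m k : nat) (c : R) :
  (forall j x, (j < m)%N -> `|x - x0| <= (m - j.+1)%:R * h ->
     G (psi j) x + t * a (k + j)%N x <= psi j.+1 x) ->
  (forall x, `|x - x0| <= m%:R * h -> u k x <= psi 0%N x + c) ->
  u (k + m)%N x0 <= psi m x0 + c.
Proof.
move=> Hpsi Hc.
suff P j : (j <= m)%N -> forall x, `|x - x0| <= (m - j)%:R * h ->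
    u (k + j)%N x <= psi j x + c.
  by apply: P => //; rewrite subnn mul0r subrr normr0.
elim: j => [_ x|j IH jm x xm]; first by rewrite addn0 subn0; exact: Hc.
rewrite addnS rec; apply: le_trans (lerD (Hpsi j x jm xm) (lexx c)).
rewrite addrAC lerD2r; apply: scheme_le_addr => // [|i|i].
- apply: IH; first exact: ltnW.
  by apply: (le_trans xm); rewrite ler_wpM2r ?ler_nat ?leq_sub2l// ltW.
- by apply: IH; [exact: ltnW|apply: cone_stencil; rewrite // gtr0_norm].
- rewrite -scaleNr; apply: IH; first exact: ltnW.
  by apply: cone_stencil; rewrite // normrN gtr0_norm.
Qed.

Lemma recursion_cone_ge (psi : nat -> rV -> R) (x0 : rV) (m k : nat) (c : R) :
  (forall j x, (j < m)%N -> `|x - x0| <= (m - j.+1)%:R * h ->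
     psi j.+1 x <= G (psi j) x + t * a (k + j)%N x) ->
  (forall x, `|x - x0| <= m%:R * h -> psi 0%N x <= u k x + c) ->
  psi m x0 <= u (k + m)%N x0 + c.
Proof.
move=> Hpsi Hc.
suff P j : (j <= m)%N -> forall x, `|x - x0| <= (m - j)%:R * h ->
    psi j x <= u (k + j)%N x + c.
  by apply: P => //; rewrite subnn mul0r subrr normr0.
elim: j => [_ x|j IH jm x xm]; first by rewrite addn0 subn0; exact: Hc.
rewrite addnS rec; apply: (le_trans (Hpsi j x jm xm)).
rewrite addrAC lerD2r; apply: scheme_le_addr => // [|i|i].
- apply: IH; first exact: ltnW.
  by apply: (le_trans xm); rewrite ler_wpM2r ?ler_nat ?leq_sub2l// ltW.
- by apply: IH; [exact: ltnW|apply: cone_stencil; rewrite // gtr0_norm].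
- rewrite -scaleNr; apply: IH; first exact: ltnW.
  by apply: cone_stencil; rewrite // normrN gtr0_norm.
Qed.

End facts.

(** * Choice of the multipliers *)

Section multiplier.
Variables (IM C : R) (r : rV -> R -> R).
Hypothesis IM_ge0 : 0 <= IM.
Hypothesis r_lip : forall x I J, 0 <= I <= IM -> 0 <= J <= IM ->
  `|r x I - r x J| <= C * `|I - J|.
Hypothesis r_IM : forall x, r x IM <= 0.
Hypothesis r_0 : forall x, 0 <= r x 0.

(** With [f <= 0] this says that the supremum is 0, attained or not. *)
Definition sup_ge0 (f : rV -> R) := forall e, 0 < e -> exists x, - e < f x.

Let feasible (u : rV -> R) (I : R) := sup_ge0 (fun x => G u x + t * r x I).

(* The constraint [sup u_{k+1} = 0] holds for the largest feasible multiplier. *)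
Let next_multiplier (u : rV -> R) (J : R) : R :=
  sup [set I | J <= I <= IM /\ feasible u I].

(** A state holds [u_k] and the multiplier of the preceding step, the lower bound for the next
    choice. *)
Let next (s : (rV -> R) * R) : (rV -> R) * R :=
  (fun x => G s.1 x + t * r x (next_multiplier s.1 s.2), next_multiplier s.1 s.2).

Let invariant (s : (rV -> R) * R) :=
  [/\ 0 <= s.2 <= IM, forall x, s.1 x <= 0, sup_ge0 s.1 & feasible s.1 s.2].

(** Feasibility passes to the supremum [I] because the rate is Lipschitz in the multiplier. The new
    function is nonpositive: for [I = IM] by the sign of the rate, and for [I < IM] because a
    positive value would leave room for a larger feasible multiplier. *)
Let next_invariant s : invariant s -> s.2 <= (next s).2 /\ invariant (next s).
Proof.
case: s => u J [/= /andP[J0 JM] u0 usup feas].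
set S := [set I | J <= I <= IM /\ feasible u I].
have SJ : S J by split; rewrite ?lexx.
have hS : has_sup S by split; [exists J|exists IM => I [/andP[]]].
pose I := next_multiplier u J; rewrite -/I.
have JI : J <= I by apply: ub_le_sup => //; case: hS.
have IIM : I <= IM by apply: ge_sup; [exists J|move=> x [/andP[]]].
have I0 : 0 <= I by exact: le_trans JI.
have C0 : 0 <= `|C| + 1 by rewrite addr_ge0.
have rI x I' : 0 <= I' <= IM -> `|t * r x I - t * r x I'| <= t * (`|C| + 1) * `|I - I'|.
  move=> I'M; rewrite -mulrBr normrM gtr0_norm// -mulrA; apply: (ler_wpM2l (ltW t_gt0)).
  apply: (le_trans (r_lip x _ I'M)); first by rewrite I0.
  by rewrite ler_wpM2r// (le_trans (ler_norm _))// lerDl.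
have k0 : 0 < t * (`|C| + 1) by rewrite mulr_gt0// ltr_wpDl.
have feasI : feasible u I.
  move=> e e0; have d0 : 0 < e / 2 / (t * (`|C| + 1)) by rewrite !divr_gt0.
  have [I' [/andP[JI' I'M] feas'] I'I] := sup_adherent d0 hS.
  have [x ux] := feas' (e / 2) (divr_gt0 e0 (ltr0Sn _ 1)); exists x.
  have I'le : I' <= I by apply: ub_le_sup; [case: hS|split => //; rewrite JI'].
  have := rI x I'; rewrite I'M (le_trans J0 JI') => /(_ isT).
  rewrite (ger0_norm (_ : 0 <= I - I')) ?subr_ge0// => rII.
  have : t * (`|C| + 1) * (I - I') <= e / 2.
    rewrite mulrC -ler_pdivlMr//; move: I'I; rewrite -/S /I /next_multiplier -/S; lra.
  move: rII; rewrite ler_norml; lra.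
have le0 x : G u x + t * r x I <= 0.
  have Gu0 : G u x <= 0 by exact: scheme_le_cst.
  have [IM'|] := eqVneq I IM.
    by rewrite IM' -[leRHS]addr0 lerD// mulr_ge0_le0// ltW.
  move=> IIM'; have {}IIM' : I < IM by rewrite lt_neqAle IIM'.
  rewrite leNgt; apply/negP => pos.
  (* Raising the multiplier by [d] keeps it below [IM] and costs at most the positive value at
     [x]. *)
  pose d := Num.min (IM - I) ((G u x + t * r x I) / (t * (`|C| + 1))).
  have d0 : 0 < d by rewrite lt_min subr_gt0 IIM' divr_gt0.
  have Id : I + d <= IM by rewrite -lerBrDl ge_min lexx.
  have : I + d <= I.
    apply: ub_le_sup; first by case: hS.
    split; first by rewrite Id (le_trans JI)// lerDl ltW.
    move=> e e0; exists x; apply: (@lt_le_trans _ _ 0); first by rewrite oppr_lt0.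
    have := rI x (I + d); rewrite Id addr_ge0 ?(ltW d0)// => /(_ isT).
    rewrite opprD addrA subrr sub0r normrN (gtr0_norm d0).
    have : t * (`|C| + 1) * d <= G u x + t * r x I.
      by rewrite mulrC -ler_pdivlMr// ge_min lexx orbT.
    by rewrite ler_norml; lra.
  by rewrite gerDl leNgt d0.
split=> //=; split => //=; first by rewrite I0.
(* [I] stays feasible for the next step. Where the new function exceeds [- e / 2], [G u x <= 0]
   forces [t * r x I > - e / 2], and the scheme does not decrease the new function at [x]. *)
move=> e e0; have [x ux] := feasI (e / 2) (divr_gt0 e0 (ltr0Sn _ 1)).
exists x; rewrite -/I.
have Gu0 : G u x <= 0 by exact: scheme_le_cst.
have := scheme_ge L t H (fun y => G u y + t * r y I) x.
rewrite /=; lra.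
Qed.

Lemma controlled_recursion (u0 : rV -> R) :
  (forall x, u0 x <= 0) -> sup_ge0 u0 ->
  exists (u : nat -> rV -> R) (I : nat -> R),
    [/\ u 0%N = u0, forall k x, u k.+1 x = G (u k) x + t * r x (I k),
        forall k, 0 <= I k <= IM, forall k, I k <= I k.+1 &
        forall k, (forall x, u k x <= 0) /\ sup_ge0 (u k)].
Proof.
move=> u0le u0sup.
(* The multiplier 0 is feasible at the start, as the rate at 0 is nonnegative and the scheme does
   not decrease [u0]. *)
pose s k := iter k next (u0, 0).
have inv k : invariant (s k).
  elim: k => [|k IH]; last by case: (next_invariant IH).
  split => //=; first by rewrite lexx.
  move=> e e0; have [x ux] := u0sup e e0; exists x.
  apply: (lt_le_trans ux); rewrite -[leLHS]addr0 lerD// ?mulr_ge0 ?scheme_ge// ltW//.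
(* The multiplier used in step [k] is stored in state [k.+1]. *)
exists (fun k => (s k).1), (fun k => (s k.+1).2); split => //.
- by move=> k; case: (inv k.+1).
- by move=> k; case: (next_invariant (inv k.+1)).
- by move=> k; case: (inv k).
Qed.

End multiplier.

End recursion.

(** * Consistency with C^1 test functions *)

Section consistency.
Context {R : realType}.

Lemma line_mean_value (V : normedModType R) (f : V -> R) (q v : V) (s : R) :
  0 <= s -> (forall u, u \in `[0, s] -> differentiable f (q + u *: v)) ->
  exists2 c, c \in `[0, s] & f (q + s *: v) - f q = s * 'D_v f (q + c *: v).
Proof.
move=> s0 df; pose g (u : R) : R := f (q + u *: v).
pose dg (u : R) : R := 'D_v f (q + u *: v).
have der (u : R) : u \in `[0, s] -> is_derive u (1 : R) g (dg u).
  by move=> /df fu; apply: is_derive_line; exact/derivableP/diff_derivable.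
have H1 (u : R) : u \in `]0, s[ -> is_derive u (1 : R) g (dg u).
  by move=> us; apply: der; exact: subset_itv_oo_cc us.
have H2 : {within `[0, s], continuous g}.
  by apply: derivable_within_continuous => u us; have [] := der u us.
have [c cs E] := MVT_segment s0 H1 H2.
by exists c => //; move: E; rewrite /g scale0r addr0 subr0 mulrC.
Qed.

(** The base point [q] varies while the derivative is frozen at [p]; this uniformity comes from the
    continuity of the directional derivative and the mean value theorem. *)
Lemma C1_on_increment (V : normedModType R) (D : set V) (phi : V -> R) (p v : V) (e : R) :
  open D -> C1_on D phi -> D p -> 0 < e ->
  \forall d \near (0 : R)^'+, forall q s, `|q - p| < d -> `|s| < d ->
    `|phi (q + s *: v) - phi q - s * 'D_v phi p| <= e * `|s|.
Proof.
move=> oD Cphi Dp e0.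
have [_ /(_ v) cp] := Cphi p Dp.
have : \forall q \near p, D q /\ `|'D_v phi p - 'D_v phi q| <= e.
  apply: filterI; first exact: open_nbhs_nbhs.
  by move/cvgrPdist_le : cp => /(_ e e0).
move=> /nbhs_ballP[d /= d0 Hd].
pose d1 := d / (`|v| + 1).
have v1 : 0 < `|v| + 1 by rewrite ltr_wpDl.
have d1E : d = d1 * `|v| + d1 by rewrite /d1; field; rewrite gt_eqF.
have d10 : 0 < d1 by rewrite divr_gt0.
pose d2 := d1 / 2.
have d1d2 : d1 = 2 * d2 by rewrite /d2; field.
have d20 : 0 < d2 by rewrite divr_gt0.
(* Nonnegative increments; a negative one is reduced to them by exchanging [q] and [q + s *: v]. *)
have pos q s : `|q - p| + d2 * `|v| < d -> 0 <= s -> s < d2 ->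
    `|phi (q + s *: v) - phi q - s * 'D_v phi p| <= e * `|s|.
  move=> qp s0 sd.
  have inb u : u \in `[0, s] ->
      D (q + u *: v) /\ `|'D_v phi p - 'D_v phi (q + u *: v)| <= e.
    rewrite in_itv/= => /andP[u0 us]; apply: Hd; rewrite -ball_normE/= distrC.
    apply: le_lt_trans qp; rewrite addrAC (le_trans (ler_normD _ _))// lerD2l normrZ ger0_norm//.
    by rewrite ler_wpM2r// ltW// (le_lt_trans us).
  have [|c cs ->] := line_mean_value (f := phi) (q := q) (v := v) s0.
    by move=> u /inb[Du _]; have [] := Cphi _ Du.
  rewrite -mulrBr normrM mulrC ler_wpM2r// distrC.
  by have [] := inb c cs.
near=> r => q s qr sr.
have rd2 : r < d2 by near: r; exact: nbhs_right_lt.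
have rd3 : r * (`|v| + 1) <= d2.
  by rewrite -ler_pdivlMr//; near: r; apply: nbhs_right_le; rewrite divr_gt0.
have [s0|s0] := leP 0 s.
  apply: pos => //; last by rewrite (ger0_norm s0) in sr; exact: lt_trans rd2.
  by rewrite d1E d1d2; have := mulr_ge0 (ltW d20) (normr_ge0 v); lra.
have := pos (q + s *: v) (- s).
rewrite scaleNr addrK normrN mulNr => H.
rewrite -[leLHS]normrN; apply: le_trans (H _ _ _).
- by rewrite le_eqVlt; apply/orP; left; apply/eqP; congr (`|_|); ring.
- rewrite addrAC; apply: (@le_lt_trans _ _ (`|q - p| + `|s| * `|v| + d2 * `|v|)).
    by rewrite lerD2r -normrZ ler_normD.
  have : `|s| * `|v| <= r * `|v| by rewrite ler_wpM2r// ltW.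
  by rewrite d1E d1d2; have := mulr_ge0 (ltW d20) (normr_ge0 v); lra.
- by rewrite oppr_ge0 ltW.
- by rewrite -ltr0_norm// (lt_trans sr).
Unshelve. all: by end_near. Qed.

(** First-order expansions suffice: in the symmetric average the gradient terms cancel, and the
    remainder [o(h)] is [o(t)] because [h = n L t]. *)
Lemma lax_friedrichs_consistent n (D : set ('rV[R]_n * R)) (phi : 'rV[R]_n * R -> R)
    (p : 'rV[R]_n * R) (L e : R) (H : 'rV[R]_n -> R) :
  (0 < n)%N -> 0 < L -> (forall p q, `|H p - H q| <= L * `|p - q|) ->
  open D -> C1_on D phi -> D p -> 0 < e ->
  \forall d \near (0 : R)^'+, forall x s t,
    `|(x, s) - p| < d -> 0 < t -> n%:R * L * t < d ->
    `|lax_friedrichs (n%:R * L * t) t H (fun y => phi (y, s)) x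
      - phi (x, s) - t * H (space_gradient phi p)| <= e * t.
Proof.
move=> n0 L0 HL oD Cphi Dp e0.
have nR : 0 < n%:R :> R by rewrite ltr0n.
(* The average contributes [e1 * h = e1 * n * L * t] and the Hamiltonian [t * L * e1]. *)
pose e1 := e / ((n%:R + 1) * L).
have nL0 : 0 < (n%:R + 1) * L by rewrite mulr_gt0// addr_gt0.
have e10 : 0 < e1 by rewrite divr_gt0.
have : \forall d \near (0 : R)^'+, forall i : 'I_n, forall q s, `|q - p| < d -> `|s| < d ->
    `|phi (q + s *: ((delta_mx ord0 i, 0) : 'rV[R]_n * R)) - phi q
      - s * 'D_((delta_mx ord0 i, 0) : 'rV[R]_n * R) phi p| <= e1 * `|s|.
  apply: filter_forall => i.
  have H1 := @C1_on_increment _ D phi p ((delta_mx ord0 i, 0) : 'rV[R]_n * R) e1 oD Cphi Dp e10.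
  exact: H1.
apply: filterS => d Hd x s t xs t0 htd.
set h := n%:R * L * t in htd *.
have h0 : 0 < h by rewrite !mulr_gt0.
have shiftE i (k : R) : (x, s) + k *: ((delta_mx ord0 i, 0) : 'rV[R]_n * R) =
    (x + k *: delta_mx ord0 i, s).
  by apply: injective_projections => //=; rewrite /GRing.scale/= mulr0 addr0.
have up i : `|phi (x + h *: delta_mx ord0 i, s) - phi (x, s)
    - h * space_gradient phi p ord0 i| <= e1 * h.
  have := Hd i (x, s) h xs; rewrite (gtr0_norm h0) => /(_ htd).
  by rewrite mxE shiftE.
have um i : `|phi (x - h *: delta_mx ord0 i, s) - phi (x, s)
    + h * space_gradient phi p ord0 i| <= e1 * h.
  have := Hd i (x, s) (- h) xs; rewrite normrN (gtr0_norm h0) => /(_ htd).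
  by rewrite mxE mulNr opprK shiftE scaleNr.
have S : `|(2 * n%:R)^-1 * (\sum_i (phi (x + h *: delta_mx ord0 i, s)
    + phi (x - h *: delta_mx ord0 i, s))) - phi (x, s)| <= e1 * h.
  have n2 : 0 < 2 * n%:R :> R by rewrite mulr_gt0.
  have -> : (2 * n%:R)^-1 * (\sum_i (phi (x + h *: delta_mx ord0 i, s)
        + phi (x - h *: delta_mx ord0 i, s))) - phi (x, s)
      = (2 * n%:R)^-1 * \sum_i (phi (x + h *: delta_mx ord0 i, s)
        + phi (x - h *: delta_mx ord0 i, s) - 2 * phi (x, s)).
    rewrite sumrB sumr_const card_ord mulrBr -mulr_natr; congr (_ - _).
    by field; rewrite gt_eqF.
  rewrite normrM normfV (gtr0_norm n2) mulrC ler_pdivrMr//.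
  apply: (le_trans (ler_norm_sum _ _ _)).
  apply: (@le_trans _ _ (\sum_(i < n) (2 * (e1 * h)))).
    apply: ler_sum => i _; have := up i; have := um i; rewrite !ler_norml; lra.
  by rewrite sumr_const card_ord -mulr_natr le_eqVlt; apply/orP; left; apply/eqP; ring.
have Q : `|difference_quotient h (fun y => phi (y, s)) x - space_gradient phi p| <= e1.
  apply: rV_norm_le => [|i]; first exact: ltW.
  have h2 : 0 < 2 * h by rewrite mulr_gt0.
  rewrite 2!mxE [X in _ + X]mxE -[X in _ - X](mulfK (lt0r_neq0 h2)) -mulrBl.
  rewrite normrM normfV (gtr0_norm h2) ler_pdivrMr//.
  by have := up i; have := um i; rewrite !ler_norml; lra.
have HQ := le_trans (HL _ _) (ler_wpM2l (ltW L0) Q).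
have tHQ : `|t * H (difference_quotient h (fun y => phi (y, s)) x)
    - t * H (space_gradient phi p)| <= t * (L * e1).
  by rewrite -mulrBr normrM (gtr0_norm t0) ler_wpM2l// ltW.
have -> : e * t = e1 * h + t * (L * e1).
  rewrite /h /e1; field; rewrite gt_eqF//= gt_eqF// addr_gt0//.
rewrite /lax_friedrichs.
move: S tHQ; set A := _ * _; set B := _ * H _; set C := _ * H _; rewrite !ler_norml; lra.
Qed.

End consistency.

(** * Passage to the limit *)

Lemma near_dist_lt {R : realType} (V : normedModType R) (p : V) (P : set V) :
  (\forall q \near p, P q) -> \forall d \near (0 : R)^'+, forall q, `|q - p| < d -> P q.
Proof.
move=> /nbhs_ballP[e /= e0 He]; near=> d => q qd.
apply: He; rewrite -ball_normE/= distrC; apply: (lt_le_trans qd).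
by near: d; exact: nbhs_right_le.
Unshelve. all: by end_near. Qed.

Lemma open_space_time {R : realType} n (T : R) :
  open (space_time `]0, T[ : set ('rV[R]_n * R)).
Proof.
apply: (@open_comp _ _ snd `]0, T[%classic); last exact: interval_open.
by move=> q _; exact: cvg_snd.
Qed.

(** * Lipschitz bounds uniform in the time step *)

Section discrete_estimates.
Context {R : realType} {n : nat}.
Local Notation rV := 'rV[R]_n.
Variables (L T IM Ka M K0 : R) (H u0 : rV -> R) (r : rV -> R -> R).
Variables (t : R) (u : nat -> rV -> R) (I : nat -> R).
Hypothesis n_gt0 : (0 < n)%N.
Hypothesis L_gt0 : 0 < L.
Hypothesis H_lip : forall p q, `|H p - H q| <= L * `|p - q|.
Hypothesis H0 : H 0 = 0.
Hypothesis r_lipx : forall x y J, 0 <= J <= IM -> `|r x J - r y J| <= Ka * `|x - y|.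
Hypothesis r_bound : forall x J, 0 <= J <= IM -> `|r x J| <= M.
Hypothesis u0_lip : forall x y, `|u0 x - u0 y| <= K0 * `|x - y|.
Hypothesis K0_ge0 : 0 <= K0.
Hypothesis Ka_ge0 : 0 <= Ka.
Hypothesis M_ge0 : 0 <= M.
Hypothesis t_gt0 : 0 < t.
Hypothesis u_0 : u 0%N = u0.
Hypothesis rec : forall k x, u k.+1 x = scheme (n%:R * L * t) t H (u k) x + t * r x (I k).
Hypothesis I_itv : forall k, 0 <= I k <= IM.

Let K := K0 + T * Ka.
Let C := (n%:R + 1) * L * K + M.

Lemma discrete_lipschitz k : k%:R * t <= T -> forall x y, `|u k x - u k y| <= K * `|x - y|.
Proof.
move=> kT x y.
have u0L : forall x y, `|u 0%N x - u 0%N y| <= K0 * `|x - y| by rewrite u_0.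
have aL : forall k x y, `|r x (I k) - r y (I k)| <= Ka * `|x - y| by move=> *; exact: r_lipx.
apply: (le_trans (recursion_lipschitz n_gt0 L_gt0 t_gt0 H_lip rec k u0L aL x y)).
by rewrite ler_wpM2r// /K lerD2l ler_wpM2r.
Qed.

Lemma discrete_increment k j x : (k <= j)%N -> j%:R * t <= T ->
  `|u j x - u k x| <= C * (j%:R * t - k%:R * t).
Proof.
move=> /subnKC <-; elim: (j - k)%N => [|m IH]; first by rewrite addn0 !subrr normr0 mulr0.
rewrite addnS => mT.
have mT' : (k + m)%:R * t <= T.
  by apply: le_trans mT; rewrite ler_wpM2r ?ler_nat// ltW.
have K_ge0 : 0 <= K.
  rewrite /K addr_ge0// mulr_ge0// (le_trans _ mT')// mulr_ge0// ltW//.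
have inc := recursion_increment n_gt0 L_gt0 t_gt0 H_lip H0 rec (x := x) K_ge0
  (discrete_lipschitz mT') (r_bound x (I_itv _)).
rewrite -/C in inc.
apply: (le_trans (ler_distD (u (k + m)%N x) _ _)); apply: (le_trans (lerD inc (IH mT'))).
by rewrite le_eqVlt; apply/orP; left; apply/eqP; rewrite -natr1; ring.
Qed.

End discrete_estimates.

Section limit.
Context {R : realType} {n : nat}.
Local Notation rV := 'rV[R]_n.
Variables (L T IM CI Ka M K0 M0 : R) (H u0 : rV -> R) (r : rV -> R -> R).
Hypothesis n_gt0 : (0 < n)%N.
Hypothesis L_gt0 : 0 < L.
Hypothesis T_gt0 : 0 < T.
Hypothesis IM_ge0 : 0 <= IM.
Hypothesis H_lip : forall p q, `|H p - H q| <= L * `|p - q|.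
Hypothesis H_ge0 : forall p, 0 <= H p.
Hypothesis H0 : H 0 = 0.
Hypothesis r_lipI : forall x I J, 0 <= I <= IM -> 0 <= J <= IM ->
  `|r x I - r x J| <= CI * `|I - J|.
Hypothesis r_anti : forall x I J, 0 <= I -> I <= J -> J <= IM -> r x J <= r x I.
Hypothesis r_lipx : forall x y J, 0 <= J <= IM -> `|r x J - r y J| <= Ka * `|x - y|.
Hypothesis r_bound : forall x J, 0 <= J <= IM -> `|r x J| <= M.
Hypothesis u0_lip : forall x y, `|u0 x - u0 y| <= K0 * `|x - y|.
Hypothesis u0_bound : forall x, `|u0 x| <= M0.
Hypothesis K0_ge0 : 0 <= K0.
Hypothesis Ka_ge0 : 0 <= Ka.
Hypothesis CI_gt0 : 0 < CI.
Hypothesis M_ge0 : 0 <= M.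

Variable tau : nat -> R.
Hypothesis tau_gt0 : forall N, 0 < tau N.
Hypothesis tau_le1 : forall N, tau N <= 1.
Variables (u : nat -> nat -> rV -> R) (I : nat -> nat -> R).
Hypothesis u_0 : forall N, u N 0%N = u0.
Hypothesis rec : forall N k x,
  u N k.+1 x = scheme (n%:R * L * tau N) (tau N) H (u N k) x + tau N * r x (I N k).
Hypothesis I_itv : forall N k, 0 <= I N k <= IM.
Hypothesis I_homo : forall N, {homo I N : j k / (j <= k)%N >-> j <= k}.
Hypothesis u_le0 : forall N k x, u N k x <= 0.
Hypothesis u_sup : forall N k, sup_ge0 (u N k).

Variable U : set_system nat.
Hypothesis U_ultra : UltraFilter U.
Hypothesis tau_cvg : forall e, 0 < e -> \forall N \near U, tau N < e.

Let K := K0 + T * Ka.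
Let C := (n%:R + 1) * L * K + M.
(** The number of whole steps up to time [s]; [v] and [J] are piecewise constant in time. *)
Let idx N (s : R) : nat := Num.truncn (s / tau N).
Let v N (s : R) := u N (idx N s).
Let J N s := I N (idx N s).

Let idxP N s : 0 <= s -> (idx N s)%:R * tau N <= s < (idx N s)%:R * tau N + tau N.
Proof.
move=> s0; have := @truncn_itv _ (s / tau N).
rewrite divr_ge0// ?(ltW (tau_gt0 N))// => /(_ isT)/andP[h1 h2].
by rewrite -ler_pdivlMr// h1 -[X in _ + X]mul1r -mulrDl -ltr_pdivrMr// natr1.
Qed.

Let idx_homo N s s' : s <= s' -> (idx N s <= idx N s')%N.
Proof. by move=> ss'; apply: le_truncn; apply: ler_wpM2r => //; rewrite invr_ge0 ltW. Qed.

Let K_ge0 : 0 <= K. Proof. by rewrite addr_ge0// mulr_ge0// ltW. Qed.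
Let C_ge0 : 0 <= C.
Proof. by rewrite addr_ge0// !mulr_ge0// ?addr_ge0// ltW. Qed.

Let v_lip N s : 0 <= s <= T -> forall x y, `|v N s x - v N s y| <= K * `|x - y|.
Proof.
move=> /andP[s0 sT]; have /andP[h _] := idxP N s0.
exact: (discrete_lipschitz n_gt0 L_gt0 H_lip r_lipx u0_lip Ka_ge0 (tau_gt0 N) (u_0 N) (rec N)
  (I_itv N) (le_trans h sT)).
Qed.

(** The additional [tau N] pays for rounding both times to the grid; it disappears in the limit. *)
Let v_time N s s' x : 0 <= s -> s <= s' -> s' <= T ->
  `|v N s' x - v N s x| <= C * (s' - s + tau N).
Proof.
move=> s0 ss' s'T; have /andP[h1 h2] := idxP N s0.
have /andP[h3 h4] := idxP N (le_trans s0 ss').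
have := discrete_increment n_gt0 L_gt0 H_lip H0 r_lipx r_bound u0_lip K0_ge0 Ka_ge0 
  (tau_gt0 N) (u_0 N) (rec N) (I_itv N) x (idx_homo N ss') (le_trans h3 s'T).
move/le_trans; apply; apply: (ler_wpM2l C_ge0); lra.
Qed.

Let v_bound N s x : 0 <= s <= T -> `|v N s x| <= M0 + C * (T + 1).
Proof.
move=> /andP[s0 sT].
have v0 : v N 0 x = u0 x by rewrite /v /idx mul0r truncn0 u_0.
have := v_time N x (lexx 0) s0 sT; rewrite v0 subr0 => h1.
have : C * (s + tau N) <= C * (T + 1).
  by apply: (ler_wpM2l C_ge0); apply: lerD.
have := ler_normD (v N s x - u0 x) (u0 x); rewrite subrK; have := u0_bound x; lra.
Qed.

Definition limit_solution (p : rV * R) : R := lim ((fun N => v N p.2 p.1) @ U).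
Let w := limit_solution.

Let w_cvg x s : 0 <= s <= T -> (fun N => v N s x) @ U --> w (x, s).
Proof. by move=> sT; apply: (ultra_bounded_cvg U_ultra (fun N => v_bound N x sT)). Qed.

Let w_lip x y s : 0 <= s <= T -> `|w (x, s) - w (y, s)| <= K * `|x - y|.
Proof.
move=> sT; have cx := @w_cvg x _ sT; have cy := @w_cvg y _ sT.
apply: (cvg_ultra_norm_le U_ultra (cvgB cx cy)).
by apply: nearW => N; exact: v_lip.
Qed.

Let w_time x s s' : 0 <= s -> s <= s' -> s' <= T -> `|w (x, s') - w (x, s)| <= C * (s' - s).
Proof.
move=> s0 ss' s'T.
have sT : 0 <= s <= T by rewrite s0 (le_trans ss').
have s'T' : 0 <= s' <= T by rewrite s'T (le_trans s0).
apply/ler_addgt0Pl => e e0.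
apply: (cvg_ultra_norm_le U_ultra (cvgB (@w_cvg x _ s'T') (@w_cvg x _ sT))).
have eC : 0 < e / (C + 1) by rewrite divr_gt0// ltr_wpDl.
apply: filterS (tau_cvg eC) => N; rewrite ltr_pdivlMr ?ltr_wpDl// => tN.
have := v_time N x s0 ss' s'T; have := tau_gt0 N; lra.
Qed.

Let w_time_abs x s s' : 0 <= s <= T -> 0 <= s' <= T ->
  `|w (x, s) - w (x, s')| <= C * `|s - s'|.
Proof.
move=> /andP[s0 sT] /andP[s'0 s'T]; have [ss'|/ltW ss'] := leP s s'.
  by rewrite distrC (distrC s) (ger0_norm (_ : 0 <= s' - s)) ?subr_ge0//; exact: w_time.
by rewrite (ger0_norm (_ : 0 <= s - s')) ?subr_ge0//; exact: w_time.
Qed.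

Lemma limit_solution_lipschitz_space x y s : 0 <= s <= T ->
  `|w (x, s) - w (y, s)| <= K * `|x - y|.
Proof. exact: w_lip. Qed.

Lemma limit_solution_le0 p : 0 <= p.2 <= T -> w p <= 0.
Proof.
case: p => x s /= sT; apply: (cvg_ultra_le U_ultra (@w_cvg x _ sT) (cvg_cst _)).
by apply: nearW => N; exact: u_le0.
Qed.

Lemma limit_solution_lipschitz : forall p q, 0 <= p.2 <= T -> 0 <= q.2 <= T ->
  `|w p - w q| <= (K + C) * `|p - q|.
Proof.
move=> [x s] [y s'] /= sT s'T.
have h1 := w_lip x y sT.
have h2 := w_time_abs y sT s'T.
have h3 : `|x - y| <= `|(x, s) - (y, s')| by rewrite /Num.norm/= le_max lexx.
have h4 : `|s - s'| <= `|(x, s) - (y, s')| by rewrite {2}/Num.norm/= le_max lexx orbT.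
have := ler_distD (w (y, s)) (w (x, s)) (w (y, s')).
have := ler_wpM2l K_ge0 h3; have := ler_wpM2l C_ge0 h4; lra.
Qed.

Lemma limit_solution_bound p : 0 <= p.2 <= T -> `|w p| <= M0 + C * (T + 1).
Proof.
case: p => x s /= sT.
apply: (cvg_ultra_norm_le U_ultra (@w_cvg x _ sT)).
by apply: nearW => N; exact: v_bound.
Qed.

Lemma limit_solution_initial x : w (x, 0) = u0 x.
Proof.
rewrite /w /limit_solution /= (_ : (fun N => _) = cst (u0 x)).
  by apply: cvg_lim => //; exact: cvg_cst.
by apply/funext => N; rewrite /v /idx mul0r truncn0 u_0.
Qed.

(* The multipliers of the scheme need not vanish at time 0, where the limit may jump. *)
Definition limit_multiplier (s : R) : R := if s <= 0 then 0 else lim (J ^~ s @ U).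

Let J_cvg s : 0 < s -> (J ^~ s) @ U --> limit_multiplier s.
Proof.
move=> s0; rewrite /limit_multiplier leNgt s0/=.
apply: (@ultra_bounded_cvg _ U _ IM U_ultra) => N.
by have /andP[h1 h2] := I_itv N (idx N s); rewrite ger0_norm.
Qed.

Lemma limit_multiplier_itv s : 0 <= limit_multiplier s <= IM.
Proof.
have [s0|s0] := leP s 0; first by rewrite /limit_multiplier s0 lexx.
apply/andP; split.
  apply: (cvg_ultra_le U_ultra (cvg_cst _) (J_cvg s0)).
  by apply: nearW => N; have /andP[] := I_itv N (idx N s).
apply: (cvg_ultra_le U_ultra (J_cvg s0) (cvg_cst _)).
by apply: nearW => N; have /andP[] := I_itv N (idx N s).
Qed.

Lemma limit_multiplier_homo s s' : s <= s' -> limit_multiplier s <= limit_multiplier s'.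
Proof.
move=> ss'; have [s0|s0] := leP s 0.
  by rewrite {1}/limit_multiplier s0; have /andP[] := limit_multiplier_itv s'.
apply: (cvg_ultra_le U_ultra (J_cvg s0) (J_cvg (lt_le_trans s0 ss'))).
by apply: nearW => N; exact/I_homo/idx_homo.
Qed.

Let box (x : rV) (rho : R) : set rV :=
  [set z | forall i, `[x ord0 i - rho, x ord0 i + rho]%classic (z ord0 i)].

Let box_compact x rho : compact (box x rho).
Proof.
apply: (@rV_compact R n (fun i => `[x ord0 i - rho, x ord0 i + rho]%classic)) => i.
exact: segment_compact.
Qed.

Let boxP x rho z : `|z - x| <= rho -> box x rho z.
Proof.
move=> zx i; have := le_trans (rV_coord_le (z - x) i) zx; rewrite !mxE ler_norml.
rewrite /= in_itv/=; lra.
Qed.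

(* Near-maximum points [y N] may escape to infinity. The data seen from [y N]
   converge uniformly on the domain of dependence, so that for U-many [N] the
   data seen from [y N] and from a fixed [y N0] are close. *)
Lemma limit_solution_sup s e : 0 <= s <= T -> 0 < e -> exists x, - e < w (x, s).
Proof.
move=> /[dup] sT /andP[s0 sleT] e0.
(* The total loss is [e1] for near-maximality plus [2 * e1 * (1 + T)] for the data. *)
pose e1 := e / (2 * (T + 1) + 2) / 2.
have e10 : 0 < e1 by rewrite divr_gt0// divr_gt0//; lra.
have e1E : e = e1 * (4 * (T + 1) + 4) by rewrite /e1; field; apply/eqP; lra.
have /choice[y Hy] : forall N, exists y, - e1 < v N s y by move=> N; exact: u_sup.
(* The rate is Lipschitz in the multiplier only on [[0, IM]]; clipping makes [g] Lipschitz on the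
   whole space. *)
pose clip (J : R) := Num.max 0 (Num.min IM J).
have clip_itv J' : 0 <= clip J' <= IM.
  by rewrite /clip le_max lexx ge_max IM_ge0 ge_min lexx.
have clip_id J' : 0 <= J' <= IM -> clip J' = J'.
  by move=> /andP[h1 h2]; rewrite /clip min_r// max_r.
have clip_lip a b : `|clip a - clip b| <= `|a - b| by exact: clamp_lipschitz.
(* Speed of propagation times [T], which contains every domain of dependence up to time [T]. *)
pose rho := n%:R * L * T.
pose f N z := u0 (y N + z).
pose g N (p : rV * R) := r (y N + p.1) (clip p.2).
have fE N z z' : `|f N z - f N z'| <= K0 * `|z - z'|.
  by apply: (le_trans (u0_lip _ _)); rewrite opprD addrACA subrr add0r.
have gE N p q : `|g N p - g N q| <= (Ka + CI) * `|p - q|.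
  case: p q => [z a] [z' b].
  have h1 : `|z - z'| <= `|(z, a) - (z', b)| by rewrite /Num.norm/= le_max lexx.
  have h2 : `|a - b| <= `|(z, a) - (z', b)| by rewrite {2}/Num.norm/= le_max lexx orbT.
  have h3 := r_lipx (y N + z) (y N + z') (clip_itv a).
  have h4 := r_lipI (y N + z') (clip_itv a) (clip_itv b).
  rewrite opprD addrACA subrr add0r in h3.
  have h5 := ler_distD (g N (z', a)) (g N (z, a)) (g N (z', b)).
  have h6 := ler_wpM2l Ka_ge0 h1.
  have h7 := ler_wpM2l (ltW CI_gt0) (le_trans (clip_lip a b) h2).
  move: h3 h4 h5 h6 h7; rewrite /g/=; lra.
have fc z : cvg (f ^~ z @ U).
  by apply: (ultra_bounded_cvg U_ultra (B := M0)) => N; exact: u0_bound.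
have gc p : cvg (g ^~ p @ U).
  by apply: (ultra_bounded_cvg U_ultra (B := M)) => N; exact: r_bound.
have flE z z' : `|lim (f ^~ z @ U) - lim (f ^~ z' @ U)| <= K0 * `|z - z'|.
  apply: (cvg_ultra_norm_le U_ultra (cvgB (fc z) (fc z'))).
  by apply: nearW => N; exact: fE.
have glE p q : `|lim (g ^~ p @ U) - lim (g ^~ q @ U)| <= (Ka + CI) * `|p - q|.
  apply: (cvg_ultra_norm_le U_ultra (cvgB (gc p) (gc q))).
  by apply: nearW => N; exact: gE.
have FU : Filter U by exact: filter_filter.
have Hf := compact_equilipschitz_cvg (@box_compact 0 rho) FU e10 fE flE fc.
have Hg := compact_equilipschitz_cvg (compact_setX (@box_compact 0 rho) (@segment_compact R 0 IM))
   FU e10 gE glE gc.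
have UHfg := @filterI _ U FU _ _ Hf Hg.
have [N0 [Hf0 Hg0]] := filter_ex UHfg.
exists (y N0); apply: (@lt_le_trans _ _ (- e1 - 2 * e1 * (1 + T))); first by rewrite e1E; nra.
apply: (cvg_ultra_le U_ultra (cvg_cst _) (@w_cvg (y N0) _ sT)).
(* The same iterate [u N] is viewed from [y N] and from [y N0]: near-maximality at the former passes
   to the latter, which is fixed as [N] varies along [U]. *)
apply: filterS UHfg => N [HfN HgN].
have /andP[hk _] := idxP N s0.
have in0 z : `|z| <= rho -> box 0 rho z by move=> zr; apply: boxP; rewrite subr0.
have := @recursion_local R n L (tau N) H n_gt0 L_gt0 (tau_gt0 N) H_lip (u N)
   (fun k x => r x (I N k)) (rec N) (2 * e1) rho (y N) (y N0) (idx N s) _ _ 0.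
rewrite !addr0 normr0 add0r => loc.
have : u N (idx N s) (y N) <= u N (idx N s) (y N0) + 2 * e1 * (1 + (idx N s)%:R * tau N).
  apply: loc.
  - move=> z zr; rewrite u_0; have := HfN z (in0 z zr); have := Hf0 z (in0 z zr).
    rewrite /f !ler_norml; lra.
  - move=> k z zr.
    have inb : (box 0 rho `*` `[0, IM]%classic) (z, I N k).
      by split; [exact: in0|rewrite /= in_itv/=; exact: I_itv].
    have := HgN _ inb; have := Hg0 _ inb.
    rewrite /g /= clip_id ?I_itv// !ler_norml; lra.
  - rewrite /rho (_ : _ * (n%:R * L * tau N) = n%:R * L * ((idx N s)%:R * tau N)); last by ring.
    by apply: ler_wpM2l; [rewrite mulr_ge0// ltW|exact: le_trans sleT].
have := Hy N; rewrite /v.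
have : e1 * ((idx N s)%:R * tau N) <= e1 * T by rewrite ler_wpM2l ?(ltW e10)// (le_trans hk).
lra.
Qed.

(* The discrete backward cone with apex [p] and height [m] time steps: the scheme
   is consistent with [phi] on it, [P] holds on its base, and the error [e] of the
   limit at the base and at the apex is small compared with [eta] times its height. *)
Lemma cone_approximation (phi : rV * R -> R) (p : rV * R) (eta eta1 : R)
    (P : set (rV * R)) (Q : set R) :
  C1_on (space_time `]0, T[) phi -> space_time `]0, T[ p -> 0 < eta -> 0 < eta1 ->
  (\forall q \near p, P q) -> (\forall s \near p.2, Q s) ->
  exists (N k m : nat) (e : R), let t := tau N in let h := n%:R * L * t in
  [/\ forall j x, (j < m)%N -> `|x - p.1| <= (m - j.+1)%:R * h ->
        let s := p.2 - (m - j)%:R * t in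
        [/\ `|lax_friedrichs h t H (fun y => phi (y, s)) x - phi (x, s)
              - t * H (space_gradient phi p)| <= eta * t,
            `|phi (x, p.2 - (m - j.+1)%:R * t) - phi (x, s)
              - t * time_derivative phi p| <= eta * t &
            Ka * `|x - p.1| <= eta],
      forall x, `|x - p.1| <= m%:R * h ->
        P (x, p.2 - m%:R * t) /\ `|u N k x - w (x, p.2 - m%:R * t)| <= e,
      `|u N (k + m)%N p.1 - w p| <= e /\ 2 * e < eta * (m%:R * t) &
      exists2 s, Q s & forall j, (j <= m)%N ->
        limit_multiplier s - eta1 <= I N (k + j)%N <= limit_multiplier p.2 + eta1].
Proof.
case: p => x0 t0 Cphi pD eta0 eta10 nearP nearQ.
have /andP[t00 t0T] : 0 < t0 < T by move: pD; rewrite /space_time/= in_itv.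
have oD := @open_space_time R n T.
pose lam := n%:R * L; have lam0 : 0 < lam by rewrite mulr_gt0// ltr0n.
have [d [[[Hlf Hti] [HP HQ]] [[d0 dt0] [dT dKa]]]] : exists d : R,
   (((forall x s t, `|(x, s) - (x0, t0)| < d -> 0 < t -> n%:R * L * t < d ->
    `|lax_friedrichs (n%:R * L * t) t H (fun y => phi (y, s)) x
      - phi (x, s) - t * H (space_gradient phi (x0, t0))| <= eta * t) /\
   (forall q s, `|q - (x0, t0)| < d -> `|s| < d ->
    `|phi (q + s *: ((0, 1) : rV * R)) - phi q - s * time_derivative phi (x0, t0)|
      <= eta * `|s|)) /\
   ((forall q, `|q - (x0, t0)| < d -> P q) /\ (forall q, `|q - t0| < d -> Q q))) /\
   ((0 < d /\ d < t0) /\ (d < T - t0 /\ d <= eta / (Ka + 1))).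
  apply: (@filter_ex _ ((0 : R)^'+)); apply: filterI; [apply: filterI|apply: filterI].
  - apply: filterI; first exact: (lax_friedrichs_consistent n_gt0 L_gt0 H_lip oD Cphi pD eta0).
    have H1 := @C1_on_increment _ _ _ phi (x0, t0) ((0, 1) : rV * R) eta oD Cphi pD eta0.
    exact: H1.
  - apply: filterI; first exact: near_dist_lt.
    exact: near_dist_lt.
  - by apply: filterI; [exact: nbhs_right_gt|exact: nbhs_right_lt].
  - apply: filterI; first by apply: nbhs_right_lt; rewrite subr_gt0.
    by apply: nbhs_right_le; rewrite divr_gt0// ltr_wpDl.
(* The approximate height of the cone. Its radius is then at most [2 * lam * A < d]. *)
pose A := d / (4 * (lam + 1)).
have lam1 : 0 < lam + 1 by rewrite addr_gt0.
have A0 : 0 < A by rewrite divr_gt0// mulr_gt0.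
have AE : d = 4 * (lam * A) + 4 * A by rewrite /A; field; rewrite gt_eqF.
have lamA0 : 0 < lam * A by rewrite mulr_gt0.
(* The errors at base and apex are at most [2 * e0] each, in total [4 * e0]; the discrete height
   exceeds [A / 2], so the gain exceeds [8 * e0]. *)
pose e0 := eta * A / 16.
have e00 : 0 < e0 by rewrite divr_gt0// mulr_gt0.
have e0E : eta * A = 16 * e0 by rewrite /e0; field.
clearbody A e0.
have C1 : 0 < C + 1 by rewrite ltr_wpDl.
have tA : 0 <= t0 - A <= T by lra.
have t0T' : 0 <= t0 <= T by lra.
have tA0 : 0 < t0 - A by lra.
have [N [[[tN1 tN2] [Hv Hv0]] [HJ HJ0]]] : exists N,
   (((tau N < A / 2) /\ (tau N < e0 / (C + 1))) /\
   ((forall z, box x0 d z -> `|v N (t0 - A) z - w (z, t0 - A)| <= e0) /\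
    (`|w (x0, t0) - v N t0 x0| <= e0))) /\
   ((`|limit_multiplier (t0 - A) - J N (t0 - A)| <= eta1) /\
    (`|limit_multiplier t0 - J N t0| <= eta1)).
  apply: (@filter_ex _ U); apply: filterI; [apply: filterI; apply: filterI|apply: filterI].
  - by apply: tau_cvg; rewrite divr_gt0.
  - by apply: tau_cvg; rewrite divr_gt0.
  - have cv := fun x => @w_cvg x _ tA.
    have FU : Filter U by exact: filter_filter.
    have := @compact_equilipschitz_cvg _ _ _ U (fun N => v N (t0 - A)) (fun z => w (z, t0 - A)) K e0
       (@box_compact x0 d) FU e00.
    apply => //; first by move=> k x y; exact: v_lip.
    by move=> x y; exact: w_lip.
  - by have /cvgrPdist_le/(_ e0 e00) := @w_cvg x0 _ t0T'.
  - by have /cvgrPdist_le/(_ eta1 eta10) := J_cvg tA0.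
  - by have /cvgrPdist_le/(_ eta1 eta10) := J_cvg t00.
have t_gt0 := tau_gt0 N.
have /andP[k1a k1b] := idxP N (ltW t00).
have /andP[k0a k0b] := idxP N (ltW tA0).
have k01 : (idx N (t0 - A) <= idx N t0)%N by apply: idx_homo; lra.
(* One [e0] is the error of the limit, the other covers rounding: times are counted back from [t0],
   so the base time differs from [t0 - A] by at most one step. *)
exists N, (idx N (t0 - A)), (idx N t0 - idx N (t0 - A))%N, (2 * e0); rewrite /=.
set m := (idx N t0 - _)%N.
have mE : (m%:R * tau N) = (idx N t0)%:R * tau N - (idx N (t0 - A))%:R * tau N.
  by rewrite /m natrB// mulrBl.
have mt1 : A - tau N <= m%:R * tau N by rewrite mE; lra.
have mt2 : m%:R * tau N <= A + tau N by rewrite mE; lra.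
have lamt : lam * tau N <= lam * (A / 2) by rewrite ler_wpM2l// ltW.
have lammt : m%:R * (n%:R * L * tau N) <= 2 * (lam * A).
  rewrite (_ : _ * _ = lam * (m%:R * tau N)); last by rewrite /lam; ring.
  by have := ler_wpM2l (ltW lam0) mt2; lra.
have Ct : C * tau N <= e0.
  by move: tN2; rewrite ltr_pdivlMr//; lra.
have dist_lt (x : rV) s : `|x - x0| < d -> `|s - t0| < d -> `|(x, s) - (x0, t0)| < d.
  by move=> h1 h2; rewrite /Num.norm/= gt_max h1.
split.
- move=> j x jm xm.
  have mj : (m - j)%:R = (m - j.+1)%:R + 1 :> R by rewrite natr1 subnSK.
  have mjm : (m - j)%:R * tau N <= m%:R * tau N.
    by apply: ler_wpM2r; [exact: ltW|rewrite ler_nat leq_subr].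
  have mj0 : 0 <= (m - j)%:R * tau N by rewrite mulr_ge0// ltW.
  have xd : `|x - x0| < d.
    apply: (le_lt_trans xm); apply: (@le_lt_trans _ _ (2 * (lam * A))); last by lra.
    apply: le_trans lammt; apply: ler_wpM2r; first by rewrite !mulr_ge0// ltW.
    by rewrite ler_nat leq_subr.
  have sd : `|t0 - (m - j)%:R * tau N - t0| < d.
    by rewrite addrAC subrr add0r normrN ger0_norm//; lra.
  split.
  + by apply: Hlf; [exact: dist_lt|by []|rewrite -/lam; lra].
  + have := Hti (x, t0 - (m - j)%:R * tau N) (tau N) (dist_lt _ _ xd sd).
    rewrite (gtr0_norm t_gt0).
    have -> : (x, t0 - (m - j)%:R * tau N) + tau N *: ((0, 1) : rV * R) =
        (x, t0 - (m - j.+1)%:R * tau N).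
      apply: injective_projections => /=; first by rewrite scaler0 addr0.
      by rewrite /GRing.scale/= mulr1 mj; ring.
    by apply; lra.
  + apply: (@le_trans _ _ ((Ka + 1) * d)).
      by apply: ler_pM => //; [rewrite lerDl|exact: ltW].
    by rewrite mulrC -ler_pdivlMr// ltr_wpDl.
- move=> x xm.
  have xd : `|x - x0| < d by apply: (le_lt_trans xm); lra.
  have mT : 0 <= t0 - m%:R * tau N <= T.
    have : 0 <= m%:R * tau N by rewrite mulr_ge0// ltW.
    lra.
  split.
    apply: HP; apply: dist_lt => //; rewrite addrAC subrr add0r normrN ger0_norm; first by lra.
    by rewrite mulr_ge0// ltW.
  have h1 := Hv x (boxP (ltW xd)).
  have h2 := w_time_abs x tA mT.
  have h3 : `|t0 - A - (t0 - m%:R * tau N)| <= tau N by rewrite ler_norml; lra.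
  have h4 := ler_distD (w (x, t0 - A)) (v N (t0 - A) x) (w (x, t0 - m%:R * tau N)).
  have h5 := ler_wpM2l C_ge0 h3.
  move: h1 h2 h4 h5; rewrite /v; lra.
- split.
    by rewrite subnKC// distrC; apply: (le_trans Hv0); lra.
  have : eta * (A / 2) < eta * (m%:R * tau N) by rewrite ltr_pM2l//; lra.
  lra.
(* Monotonicity places all multipliers of the cone between [J N (t0 - A)] and [J N t0]. *)
- exists (t0 - A).
    by apply: HQ; rewrite addrAC subrr add0r normrN gtr0_norm//; lra.
  move=> j jm; apply/andP; split.
    have : J N (t0 - A) <= I N (idx N (t0 - A) + j)%N by apply: I_homo; rewrite leq_addr.
    by move: HJ; rewrite ler_norml; lra.
  have : I N (idx N (t0 - A) + j)%N <= J N t0.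
    by apply: I_homo; rewrite -(subnKC k01) leq_add2l.
  by move: HJ0; rewrite ler_norml; lra.
Qed.

Let small_multiplier eta : 0 < eta -> exists2 eta1, 0 < eta1 & CI * (2 * eta1) = eta.
Proof.
move=> eta0; exists (eta / (2 * CI)); first by rewrite divr_gt0// mulr_gt0.
by field; rewrite gt_eqF.
Qed.

(** If the inequality failed, [phi] tilted downwards in time would dominate the scheme on the cone
    and push [u N] at the apex below its limit by more than the error allows. [a] plays the part of
    the lower envelope: the cone reaches into the past, so the multipliers must be bounded below
    near [p.2] and not only at it. *)
Lemma limit_solution_subsolution (phi : rV * R -> R) (p : rV * R) (a : R) :
  C1_on (space_time `]0, T[) phi -> space_time `]0, T[ p ->
  (\forall q \near p, w q - phi q <= w p - phi p) -> 0 <= a <= IM ->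
  (forall e, 0 < e -> \forall s \near p.2, a - e <= limit_multiplier s) ->
  time_derivative phi p <= H (space_gradient phi p) + r p.1 a.
Proof.
move=> Cphi pD wphi aIM aI; rewrite leNgt; apply/negP => gap.
(* The gap [8 * eta] absorbs one [eta] each for consistency, the time expansion and the tilt, and
   two for the rate. *)
pose eta := (time_derivative phi p - (H (space_gradient phi p) + r p.1 a)) / 8.
have eta0 : 0 < eta by rewrite divr_gt0// subr_gt0.
have gapE : time_derivative phi p = H (space_gradient phi p) + r p.1 a + 8 * eta.
  by rewrite /eta; field.
have [eta1 eta10 eta1E] := small_multiplier eta0.
have [N [k [m [e /= [step base [top e_small] [s Qs mult]]]]]] :=
  cone_approximation Cphi pD eta0 eta10 wphi (aI eta1 eta10).
move: step base e_small; set t := tau N; set h := _ * _ * t => step base e_small.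
have t0 : 0 < t := tau_gt0 N.
(* [psi] is a strict discrete supersolution on the cone. *)
pose psi j x := phi (x, p.2 - (m - j)%:R * t) - eta * (j%:R * t).
have := @recursion_cone_le R n L t H n_gt0 L_gt0 t0 H_lip (u N) (fun k x => r x (I N k)) (rec N)
  psi p.1 m k (w p - phi p + e).
have psim : psi m p.1 = phi p - eta * (m%:R * t).
  by rewrite /psi subnn mul0r subr0 -surjective_pairing.
rewrite psim => /(_ _ _)-H1.
suff : u N (k + m)%N p.1 <= phi p - eta * (m%:R * t) + (w p - phi p + e).
  by move: top; rewrite ler_norml; lra.
apply: H1 => [j x jm xm|x xm]; last first.
  have [Pq] := base x xm; rewrite /psi subn0 mul0r mulr0 subr0 ler_norml; lra.
have [+ + Kx] := step j x jm xm.
set b := p.2 - (m - j)%:R * t.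
rewrite !ler_norml => /andP[_ lf] /andP[ti _].
have := mult j (ltnW jm); set J' := I N (k + j)%N => /andP[Jl _].
have rJ : r x J' <= r p.1 a + 2 * eta.
  have h1 := le_trans (r_lipx x p.1 (I_itv N (k + j)%N)) Kx.
  have h2 : r p.1 J' <= r p.1 a + eta.
    have /andP[J0 JM] := I_itv N (k + j)%N; have /andP[a0 aM] := aIM.
    have [aJ|Ja] := leP a J'.
      by apply: (@le_trans _ _ (r p.1 a)); [exact: r_anti|rewrite lerDl ltW].
    have := r_lipI p.1 (I_itv N (k + j)%N) aIM; rewrite -/J' distrC.
    have aJ : `|J' - a| <= 2 * eta1 by rewrite ltr0_norm; lra.
    have := ler_wpM2l (ltW CI_gt0) aJ; rewrite eta1E ler_norml; lra.
  by move: h1; rewrite -/J' ler_norml; lra.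
have trJ := ler_wpM2l (ltW t0) rJ.
have tH := mulr_ge0 (ltW t0) (H_ge0 (space_gradient phi p)).
have te := mulr_gt0 t0 eta0.
have sch : scheme h t H (psi j) x <=
    phi (x, b) - eta * (j%:R * t) + t * H (space_gradient phi p) + eta * t.
  (* The branch of the maximum that keeps [psi j] is harmless because [H >= 0]. *)
  rewrite /scheme ge_max; apply/andP; split; first by rewrite /psi -/b; lra.
  rewrite /psi (@lax_friedrichs_addr _ _ L t H n_gt0 (- (eta * (j%:R * t))) (fun y => phi (y, b))).
  rewrite -/h; lra.
rewrite gapE in ti.
move: sch ti trJ; rewrite /psi -natr1; lra.
Qed.

(** The tilt is upwards. A bound on the multiplier at the single time [p.2] is enough, because the
    cone lies in the past and multipliers are nondecreasing. *)
Lemma limit_solution_supersolution (phi : rV * R -> R) (p : rV * R) (a : R) :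
  C1_on (space_time `]0, T[) phi -> space_time `]0, T[ p ->
  (\forall q \near p, w p - phi p <= w q - phi q) -> 0 <= a <= IM ->
  limit_multiplier p.2 <= a ->
  H (space_gradient phi p) + r p.1 a <= time_derivative phi p.
Proof.
move=> Cphi pD wphi aIM aI; rewrite leNgt; apply/negP => gap.
pose eta := (H (space_gradient phi p) + r p.1 a - time_derivative phi p) / 8.
have eta0 : 0 < eta by rewrite divr_gt0// subr_gt0.
have gapE : time_derivative phi p = H (space_gradient phi p) + r p.1 a - 8 * eta.
  by rewrite /eta; field.
have [eta1 eta10 eta1E] := small_multiplier eta0.
have [N [k [m [e /= [step base [top e_small] [s Qs mult]]]]]] :=
  cone_approximation Cphi pD eta0 eta10 wphi (filterT : \forall s \near p.2, True).
move: step base e_small; set t := tau N; set h := _ * _ * t => step base e_small.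
have t0 : 0 < t := tau_gt0 N.
(* [psi] is a strict discrete subsolution on the cone. *)
pose psi j x := phi (x, p.2 - (m - j)%:R * t) + eta * (j%:R * t).
have := @recursion_cone_ge R n L t H n_gt0 L_gt0 t0 H_lip (u N) (fun k x => r x (I N k)) (rec N)
  psi p.1 m k (phi p - w p + e).
have psim : psi m p.1 = phi p + eta * (m%:R * t).
  by rewrite /psi subnn mul0r subr0 -surjective_pairing.
rewrite psim => /(_ _ _)-H1.
suff : phi p + eta * (m%:R * t) <= u N (k + m)%N p.1 + (phi p - w p + e).
  by move: top; rewrite ler_norml; lra.
apply: H1 => [j x jm xm|x xm]; last first.
  have [Pq] := base x xm; rewrite /psi subn0 mul0r mulr0 addr0 ler_norml; lra.
have [+ + Kx] := step j x jm xm.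
set b := p.2 - (m - j)%:R * t.
rewrite !ler_norml => /andP[lf _] /andP[_ ti].
have := mult j (ltnW jm); set J' := I N (k + j)%N => /andP[_ Jl].
have rJ : r p.1 a - 2 * eta <= r x J'.
  have h1 := le_trans (r_lipx x p.1 (I_itv N (k + j)%N)) Kx.
  have h2 : r p.1 a - eta <= r p.1 J'.
    have /andP[J0 JM] := I_itv N (k + j)%N; have /andP[a0 aM] := aIM.
    have [Ja|aJ] := leP J' a.
      by apply: (@le_trans _ _ (r p.1 a)); [rewrite gerBl ltW|exact: r_anti].
    have := r_lipI p.1 (I_itv N (k + j)%N) aIM; rewrite -/J'.
    have Ja : `|J' - a| <= 2 * eta1 by rewrite gtr0_norm; lra.
    have := ler_wpM2l (ltW CI_gt0) Ja; rewrite eta1E ler_norml; lra.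
  by move: h1; rewrite -/J' ler_norml; lra.
have trJ := ler_wpM2l (ltW t0) rJ.
have te := mulr_gt0 t0 eta0.
have sch : phi (x, b) + eta * (j%:R * t) + t * H (space_gradient phi p) - eta * t <=
    scheme h t H (psi j) x.
  apply: (@le_trans _ _ (lax_friedrichs h t H (psi j) x)); last by rewrite /scheme le_max lexx orbT.
  rewrite /psi (@lax_friedrichs_addr _ _ L t H n_gt0 (eta * (j%:R * t)) (fun y => phi (y, b))).
  rewrite -/h; lra.
rewrite gapE in ti.
move: sch ti trJ; rewrite /psi -natr1; lra.
Qed.

End limit.

(** * The constrained problem *)

(** The one-sided inequality at both [p + s e_i] and [p - s e_i] bounds the derivative on both
    sides. [b] is [false] for a test function touching from above and [true] for one touching from
    below; only points of the same time slice are compared. *)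
Lemma touching_gradient_le {R : realType} n (D : set ('rV[R]_n * R)) (phi : 'rV[R]_n * R -> R)
    (p : 'rV[R]_n * R) (K : R) (b : bool) :
  open D -> C1_on D phi -> D p ->
  (\forall q \near p, q.2 = p.2 -> - (K * `|q.1 - p.1|) <= (-1) ^+ b * (phi q - phi p)) ->
  forall i, `|space_gradient phi p ord0 i| <= K.
Proof.
move=> oD Cphi Dp touch i; apply/ler_addgt0Pl => e e0.
pose v : 'rV[R]_n * R := (delta_mx ord0 i, 0).
have H1 := @C1_on_increment R _ D phi p v e oD Cphi Dp e0.
have [d [[Hd Ht] d0]] : exists d : R,
  ((forall q s, `|q - p| < d -> `|s| < d ->
      `|phi (q + s *: v) - phi q - s * 'D_v phi p| <= e * `|s|) /\
   (forall q, `|q - p| < d -> q.2 = p.2 ->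
      - (K * `|q.1 - p.1|) <= (-1) ^+ b * (phi q - phi p))) /\ 0 < d.
  apply: (@filter_ex _ ((0 : R)^'+)); apply: filterI; [apply: filterI|exact: nbhs_right_gt].
    exact: H1.
  exact: near_dist_lt.
have norm_v : `|delta_mx ord0 i : 'rV[R]_n| = 1.
  apply/le_anti/andP; split.
    exact: rV_norm_delta_le1.
  by have := rV_coord_le (delta_mx ord0 i : 'rV[R]_n) i; rewrite mxE !eqxx normr1.
have key s : `|s| = d / 2 -> - (K * `|s|) - e * `|s| <= (-1) ^+ b * (s * 'D_v phi p).
  move=> sd.
  have sd' : `|s| < d by rewrite sd; lra.
  have := Hd p s; rewrite subrr normr0 => /(_ d0 sd').
  have := Ht (p + s *: v); rewrite [X in X - p]addrC addrK.
  have -> : `|s *: v| = `|s| by rewrite normrZ /v prod_normE/= norm_v normr0 max_l ?ler01 ?mulr1.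
  move=> /(_ sd'); rewrite {1}/v /= scaler0 addr0 => /(_ erefl).
  rewrite [p.1 + _]addrC addrK normrZ norm_v mulr1.
  by case: b {touch Ht}; rewrite ?expr1 ?expr0 ler_norml; lra.
rewrite mxE.
have d2 : 0 < d / 2 by rewrite divr_gt0.
have := key (d / 2) (gtr0_norm d2); have := key (- (d / 2)).
rewrite normrN (gtr0_norm d2) => /(_ erefl).
set Dv := 'D_v phi p; move: d2; set dd := d / 2 => dd0 h1 h2.
have h3 : dd * `|Dv| <= dd * (e + K).
  rewrite -[in X in X * `|Dv|](gtr0_norm dd0) -normrM ler_norml.
  by case: b h1 h2 {touch Ht key}; rewrite ?expr1 ?expr0; lra.
by rewrite ler_pM2l in h3.
Qed.

(** * Semicontinuous envelopes of the multiplier *)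

Section envelopes.
Context {R : realType}.
Variables (T M : R) (I : R -> R).
Hypothesis I_itv : forall t, 0 <= I t <= M.

Let F (t : R) := within `[0, T]%classic (nbhs t).

Lemma lsc_envelopeP t : 0 < t < T ->
  0 <= lsc_envelope `[0, T] I t <= M /\
  forall e, 0 < e -> \forall s \near t, lsc_envelope `[0, T] I t - e <= I s.
Proof.
move=> /andP[t0 tT].
have tA : `[0, T]%classic t by rewrite /= in_itv/= !ltW.
have nA : nbhs t `[0, T]%classic.
  have /near_in_itvoo : t \in `]0, T[ by rewrite in_itv/= t0.
  by apply: filterS => s; rewrite /= !in_itv/= => /andP[/ltW -> /ltW ->].
pose l := limf_einf (EFin \o I) (F t).
have lE : l = ereal_sup [set ereal_inf ((EFin \o I) @` V) | V in F t] by exact: limf_einfE.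
have l0 : (0 <= l)%E.
  rewrite lE; apply: le_ereal_sup_tmp; exists (ereal_inf ((EFin \o I) @` setT)).
    by exists setT => //; exact: filterT.
  by apply/ereal_infP => _ [s _ <-] /=; rewrite lee_fin; have /andP[] := I_itv s.
have lI : (l <= (I t)%:E)%E.
  rewrite lE; apply/ereal_supP => _ [V FV <-]; apply: ge_ereal_inf.
  by exists (I t)%:E => //; exists t => //; exact: (nbhs_singleton FV tA).
have lf : l \is a fin_num by rewrite ge0_fin_numE// (le_lt_trans lI)// ltry.
have -> : lsc_envelope `[0, T] I t = fine l by [].
split.
  rewrite fine_ge0//= -lee_fin fineK// (le_trans lI)// lee_fin.
  by have /andP[] := I_itv t.
move=> e e0; have : ((fine l - e)%:E < l)%E by rewrite -[ltRHS]fineK// lte_fin gtrBl.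
rewrite {2}lE => /ereal_sup_gt[_ [V FV <-]] lV.
apply: filterS2 nA FV => s As /(_ As) Vs.
rewrite -lee_fin; apply/ltW/(lt_le_trans lV)/ge_ereal_inf.
by exists (I s)%:E => //; exists s.
Qed.

Lemma usc_envelopeP t : 0 < t < T ->
  0 <= usc_envelope `[0, T] I t <= M /\ I t <= usc_envelope `[0, T] I t.
Proof.
move=> /andP[t0 tT].
have tA : `[0, T]%classic t by rewrite /= in_itv/= !ltW.
pose l := limf_esup (EFin \o I) (F t).
have lE : l = ereal_inf [set ereal_sup ((EFin \o I) @` V) | V in F t] by exact: limf_esupE.
have lM : (l <= M%:E)%E.
  rewrite lE; apply: ge_ereal_inf; exists (ereal_sup ((EFin \o I) @` setT)).
    by exists setT => //; exact: filterT.
  by apply/ereal_supP => _ [s _ <-] /=; rewrite lee_fin; have /andP[] := I_itv s.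
have lI : ((I t)%:E <= l)%E.
  rewrite lE; apply/ereal_infP => _ [V FV <-]; apply: le_ereal_sup_tmp.
  by exists (I t)%:E => //; exists t => //; exact: (nbhs_singleton FV tA).
have l0 : (0 <= l)%E by apply: le_trans lI; rewrite lee_fin; have /andP[] := I_itv t.
have lf : l \is a fin_num by rewrite ge0_fin_numE// (le_lt_trans lM)// ltry.
have -> : usc_envelope `[0, T] I t = fine l by [].
by rewrite fine_ge0//= -!lee_fin fineK.
Qed.

End envelopes.

(** Multipliers and their envelopes stay in [[0, IM]], where the extension of the rate is
    invisible. *)
Lemma extend_rate_id {R : realType} n (IM : R) (r : 'rV[R]_n -> R -> R) x I :
  0 <= I <= IM -> extend_rate IM r x I = r x I.
Proof.
move=> /andP[I0 IIM]; rewrite /extend_rate !ltNge.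
by rewrite (_ : I <= 2 * IM)/= 1?(_ : - (2 * IM) <= I)//; lra.
Qed.

Section truncated_problem.
Context {R : realType} {n : nat}.
Local Notation rV := 'rV[R]_n.
Variables (L T IM CI Ka M K0 M0 : R) (H u0 : rV -> R) (r : rV -> R -> R).
Hypothesis n_gt0 : (0 < n)%N.
Hypothesis L_gt0 : 0 < L.
Hypothesis T_gt0 : 0 < T.
Hypothesis IM_ge0 : 0 <= IM.
Hypothesis H_lip : forall p q, `|H p - H q| <= L * `|p - q|.
Hypothesis H_ge0 : forall p, 0 <= H p.
Hypothesis H0 : H 0 = 0.
Hypothesis r_lipI : forall x I J, 0 <= I <= IM -> 0 <= J <= IM ->
  `|r x I - r x J| <= CI * `|I - J|.
Hypothesis r_anti : forall x I J, 0 <= I -> I <= J -> J <= IM -> r x J <= r x I.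
Hypothesis r_lipx : forall x y J, 0 <= J <= IM -> `|r x J - r y J| <= Ka * `|x - y|.
Hypothesis r_bound : forall x J, 0 <= J <= IM -> `|r x J| <= M.
Hypothesis r_IM : forall x, r x IM <= 0.
Hypothesis r_0 : forall x, 0 <= r x 0.
Hypothesis u0_lip : forall x y, `|u0 x - u0 y| <= K0 * `|x - y|.
Hypothesis u0_bound : forall x, `|u0 x| <= M0.
Hypothesis u0_le0 : forall x, u0 x <= 0.
Hypothesis u0_sup : sup_ge0 u0.
Hypothesis K0_ge0 : 0 <= K0.
Hypothesis Ka_ge0 : 0 <= Ka.
Hypothesis CI_gt0 : 0 < CI.
Hypothesis M_ge0 : 0 <= M.

Lemma truncated_solution : exists (w : rV * R -> R) (I : R -> R) (C B : R),
  [/\ [/\ forall p q, 0 <= p.2 <= T -> 0 <= q.2 <= T -> `|w p - w q| <= C * `|p - q|,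
          forall p, 0 <= p.2 <= T -> `|w p| <= B,
          forall x y s, 0 <= s <= T -> `|w (x, s) - w (y, s)| <= (K0 + T * Ka) * `|x - y| &
          forall x, w (x, 0) = u0 x],
      (forall p, 0 <= p.2 <= T -> w p <= 0) /\
      (forall s e, 0 <= s <= T -> 0 < e -> exists x, - e < w (x, s)),
      [/\ I 0 = 0, forall s, 0 <= I s <= IM & {homo I : s t / s <= t}],
      forall phi p a, C1_on (space_time `]0, T[) phi -> space_time `]0, T[ p ->
        (\forall q \near p, w q - phi q <= w p - phi p) -> 0 <= a <= IM ->
        (forall e, 0 < e -> \forall s \near p.2, a - e <= I s) ->
        time_derivative phi p <= H (space_gradient phi p) + r p.1 a &
      forall phi p a, C1_on (space_time `]0, T[) phi -> space_time `]0, T[ p ->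
        (\forall q \near p, w p - phi p <= w q - phi q) -> 0 <= a <= IM -> I p.2 <= a ->
        H (space_gradient phi p) + r p.1 a <= time_derivative phi p].
Proof.
pose tau N : R := N.+1%:R^-1.
have tau_gt0 N : 0 < tau N by rewrite invr_gt0.
have tau_le1 N : tau N <= 1 by rewrite invf_le1// ler1n.
have /choice[uI HuI] : forall N, exists uI : (nat -> rV -> R) * (nat -> R),
    [/\ uI.1 0%N = u0,
      forall k x, uI.1 k.+1 x =
        scheme (n%:R * L * tau N) (tau N) H (uI.1 k) x + tau N * r x (uI.2 k),
      forall k, 0 <= uI.2 k <= IM, forall k, uI.2 k <= uI.2 k.+1 &
      forall k, (forall x, uI.1 k x <= 0) /\ sup_ge0 (uI.1 k)].
  move=> N.
  have [u [I HuI]] := controlled_recursion n_gt0 L_gt0 (tau_gt0 N) H_lip H0 IM_ge0 r_lipI r_IM r_0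
    u0_le0 u0_sup.
  by exists (u, I).
pose u N := (uI N).1; pose I N := (uI N).2.
have u_0 N : u N 0%N = u0 by have [] := HuI N.
have rec N k x : u N k.+1 x = scheme (n%:R * L * tau N) (tau N) H (u N k) x + tau N * r x (I N k).
  by have [_ + _ _ _] := HuI N; apply.
have I_itv N k : 0 <= I N k <= IM by have [_ _ + _ _] := HuI N; apply.
have I_homo N : {homo I N : j k / (j <= k)%N >-> j <= k}.
  by apply: homo_leq => //; [exact: le_trans|have [_ _ _ + _] := HuI N].
have u_le0 N k x : u N k x <= 0 by have [_ _ _ _ /(_ k)[h _]] := HuI N; exact: h.
have u_sup N k : sup_ge0 (u N k) by have [_ _ _ _ /(_ k)[]] := HuI N.
(* [U] refines the filter of cofinite sets, so the time steps tend to 0 along it. *)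
have [U [U_ultra U_oo]] := @ultraFilterLemma nat \oo _.
have tau_cvg e : 0 < e -> \forall N \near U, tau N < e.
  move=> e0; apply: U_oo; near=> N.
  rewrite /tau -[e]invrK ltf_pV2 ?posrE ?invr_gt0//.
  apply: (@lt_trans _ _ (N%:R)); last by rewrite ltr_nat.
  by near: N; exact: nbhs_infty_gtr.
exists (limit_solution tau u U), (limit_multiplier tau I U).
do 2 eexists; split.
- split.
  + exact: (limit_solution_lipschitz n_gt0 L_gt0 T_gt0 H_lip H0 r_lipx r_bound u0_lip u0_bound
      K0_ge0 Ka_ge0 M_ge0 tau_gt0 tau_le1 u_0 rec I_itv U_ultra tau_cvg).
  + exact: (limit_solution_bound n_gt0 L_gt0 T_gt0 H_lip H0 r_lipx r_bound u0_lip u0_bound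
      K0_ge0 Ka_ge0 M_ge0 tau_gt0 tau_le1 u_0 rec I_itv U_ultra).
  + move=> x y s; exact: (limit_solution_lipschitz_space n_gt0 L_gt0 T_gt0 H_lip H0
      r_lipx r_bound u0_lip u0_bound K0_ge0 Ka_ge0 M_ge0 tau_gt0 tau_le1 u_0 rec I_itv U_ultra).
  + exact: (limit_solution_initial _ u_0 U_ultra).
- split.
  + exact: (limit_solution_le0 n_gt0 L_gt0 T_gt0 H_lip H0 r_lipx r_bound u0_lip u0_bound
      K0_ge0 Ka_ge0 M_ge0 tau_gt0 tau_le1 u_0 rec I_itv u_le0 U_ultra).
  + move=> s e; exact: (limit_solution_sup n_gt0 L_gt0 T_gt0 IM_ge0 H_lip H0 r_lipI
      r_lipx r_bound u0_lip u0_bound K0_ge0 Ka_ge0 CI_gt0 M_ge0 tau_gt0 tau_le1 u_0 rec I_itv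
      u_sup U_ultra).
- split.
  + by rewrite /limit_multiplier lexx.
  + exact: (limit_multiplier_itv IM_ge0 _ I_itv U_ultra).
  + exact: (limit_multiplier_homo IM_ge0 tau_gt0 I_itv I_homo U_ultra).
- move=> phi p a; exact: (limit_solution_subsolution n_gt0 L_gt0 T_gt0 H_lip H_ge0 H0 r_lipI r_anti
    r_lipx r_bound u0_lip u0_bound K0_ge0 Ka_ge0 CI_gt0 M_ge0 tau_gt0 tau_le1 u_0 rec I_itv I_homo
    U_ultra tau_cvg).
- move=> phi p a; exact: (limit_solution_supersolution n_gt0 L_gt0 T_gt0 H_lip H0 r_lipI r_anti
    r_lipx r_bound u0_lip u0_bound K0_ge0 Ka_ge0 CI_gt0 M_ge0 tau_gt0 tau_le1 u_0 rec I_itv I_homo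
    U_ultra tau_cvg).
Unshelve. all: by end_near. Qed.

End truncated_problem.

Lemma ereal_lty_fin {R : realType} (x : \bar R) :
  (x < +oo)%E -> exists2 M : R, 0 < M & (x < M%:E)%E.
Proof.
case: x => [x _| |_]; [|by rewrite ltxx|by exists 1; rewrite ?ltNyr].
by exists (Num.max 0 x + 1); rewrite ?lte_fin ltr_pwDr// le_max lexx ?orbT.
Qed.

Theorem theorem3p4 (R : realType) (n : nat) (IM : R)
    (r : 'rV[R]_n -> R -> R) (u0 : 'rV[R]_n -> R) (H : 'rV[R]_n -> R)
    (n_gt0 : (0 < n)%N)
    (IM_gt0 : 0 < IM)
    (r_derivative : exists K1 K2 : R, [/\ 0 < K1, 0 < K2 &
      forall x (I : R), I \in `[- (2 * IM), 2 * IM] ->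
        exists2 l : R, has_derivative_within `[- (2 * IM), 2 * IM] (r x) I l &
          - K1 <= l <= - K2])
    (r_max : (exists x, r x IM = 0) /\ forall x, r x IM <= 0)
    (r_min : (exists x, r x 0 = 0) /\ forall x, 0 <= r x 0)
    (r_continuous : forall I : R, `|I| <= 2 * IM -> continuous (r ^~ I))
    (r_W1oo : (ereal_sup [set W1oo_norm (r ^~ I) | I in [set I : R | (`|I| <= 2 * IM)%R]]
               < +oo)%E)
    (u0_continuous : continuous u0)
    (u0_W1oo : (W1oo_norm u0 < +oo)%E)
    (u0_sup : ereal_sup [set (u0 x)%:E | x in setT] = 0%E)
    (H_ge0 : forall p, 0 <= H p)
    (H_lipschitz : locally_lipschitz H)
    (H0 : H 0 = 0)
    (T : R) (T_gt0 : 0 < T) :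
  exists (u : 'rV[R]_n * R -> R) (I : R -> R),
    [/\ bounded_uniformly_continuous_on (space_time `[0, T]) u,
        (forall t : R, t \in `[0, T] -> 0 <= I t) /\
        {in `[0, T] &, {homo I : s t / s <= t}},
        viscosity_subsolution T
          (fun x t p => H p + extend_rate IM r x (lsc_envelope `[0, T] I t)) u /\
        viscosity_supersolution T
          (fun x t p => H p + extend_rate IM r x (usc_envelope `[0, T] I t)) u,
        forall t : R, t \in `[0, T] -> ereal_sup [set (u (x, t))%:E | x in setT] = 0%E &
        I 0 = 0 /\ forall x, u (x, 0) = u0 x].

Proof.
have [K1 [K2 [K1_gt0 K2_gt0 dr]]] := r_derivative.
have [Mr Mr_gt0 rM] := ereal_lty_fin r_W1oo.
have [Mu Mu_gt0 uM] := ereal_lty_fin u0_W1oo.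
have IMT J : 0 <= J <= IM -> `|J| <= 2 * IM.
  by move=> /andP[J0 JM]; rewrite ger0_norm//; lra.
have r_reg J : 0 <= J <= IM -> (forall x, `|r x J| <= Mr) /\
    (forall x y, `|r x J - r y J| <= n%:R * Mr * `|x - y|).
  move=> JI; apply: (@W1oo_norm_lipschitz _ _ (r ^~ J)); first exact: r_continuous (IMT J JI).
  by apply: le_lt_trans rM; apply: ereal_sup_ubound; exists J => //=; exact: IMT.
have [u0_bound u0_lip] := W1oo_norm_lipschitz u0_continuous uM.
have nR_ge0 : 0 <= n%:R :> R by [].
have r_incr x I J : 0 <= I -> I <= J -> J <= IM -> 0 <= r x I - r x J <= K1 * (J - I).
  move=> I0 IJ JM.
  apply: (@derivative_bounds_increment _ (r x) (- (2 * IM)) (2 * IM) K1 K2) => //;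
    [|lra|lra|exact: ltW].
  move=> c; rewrite in_itv/= => cI.
  have cI' : c \in `[- (2 * IM), 2 * IM] by rewrite in_itv/=; lra.
  have [l dl lK] := dr x c cI'; exists l => //.
  exact: has_derivative_within_is_derive dl.
have r_lipI x I J : 0 <= I <= IM -> 0 <= J <= IM -> `|r x I - r x J| <= K1 * `|I - J|.
  move=> /andP[I0 IM'] /andP[J0 JM]; have [IJ|/ltW JI] := leP I J.
    have /andP[h1 h2] := r_incr x I J I0 IJ JM.
    by rewrite ger0_norm// distrC (ger0_norm (_ : 0 <= J - I)) ?subr_ge0.
  have /andP[h1 h2] := r_incr x J I J0 JI IM'.
  by rewrite distrC ger0_norm// (ger0_norm (_ : 0 <= I - J)) ?subr_ge0.
have r_anti x I J : 0 <= I -> I <= J -> J <= IM -> r x J <= r x I.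
  by move=> I0 IJ JM; have /andP[+ _] := r_incr x I J I0 IJ JM; rewrite subr_ge0.
have u0_le0 x : u0 x <= 0.
  have : ((u0 x)%:E <= ereal_sup [set (u0 x)%:E | x in setT])%E.
    by apply: ereal_sup_ubound; exists x.
  by rewrite u0_sup lee_fin.
have u0_sup' : sup_ge0 u0.
  move=> e e0; have : ((- e)%:E < ereal_sup [set (u0 x)%:E | x in setT])%E.
    by rewrite u0_sup lte_fin oppr_lt0.
  by move=> /ereal_sup_gt[_ [x _ <-]]; rewrite lte_fin; exists x.
(* The Lipschitz constant in [x] of the solution, fixed before [L], the Lipschitz constant of [H] on
   the box of gradients bounded by [K]. *)
pose K := n%:R * Mu + T * (n%:R * Mr).
have K_ge0 : 0 <= K by rewrite addr_ge0// !mulr_ge0// ltW.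
have box_compact : compact [set p : 'rV[R]_n | forall i, `[- K, K]%classic (p ord0 i)].
  by apply: (@rV_compact R n (fun=> `[- K, K]%classic)) => i; exact: segment_compact.
have [L L_gt0 HL] := locally_lipschitz_compact H_lipschitz box_compact.
pose HK p := H (truncate K p).
have trunc_box p : [set p : 'rV[R]_n | forall i, `[- K, K]%classic (p ord0 i)] (truncate K p).
  move=> i; rewrite /= in_itv/= -ler_norml.
  exact: (le_trans (rV_coord_le _ _) (truncate_norm _ K_ge0)).
have HK_lip p q : `|HK p - HK q| <= L * `|p - q|.
  apply: (le_trans (HL _ _ (trunc_box p) (trunc_box q))).
  by apply: (ler_wpM2l (ltW L_gt0)); exact: truncate_lipschitz.
have HK0 : HK 0 = 0.
  by rewrite /HK truncate_id// => j; rewrite mxE normr0.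
have nMr_ge0 : 0 <= n%:R * Mr by rewrite mulr_ge0// ltW.
have nMu_ge0 : 0 <= n%:R * Mu by rewrite mulr_ge0// ltW.
have [w [I [C [B [[w_lip w_bound w_lipx w_init] [w_le0 w_sup] [I0 I_itv I_homo]
    w_sub w_super]]]]] :=
  @truncated_solution R n L T IM K1 (n%:R * Mr) Mr (n%:R * Mu) Mu HK u0 r n_gt0 L_gt0 T_gt0
    (ltW IM_gt0) HK_lip (fun p => H_ge0 _) HK0 r_lipI r_anti (fun x y J JI => (r_reg J JI).2 x y)
    (fun x J JI => (r_reg J JI).1 x) r_max.2 r_min.2 u0_lip u0_bound u0_le0 u0_sup'
    nMu_ge0 nMr_ge0 K1_gt0 (ltW Mr_gt0).
have time_itv (p : 'rV[R]_n * R) : space_time `]0, T[ p -> 0 < p.2 < T.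
  by rewrite /space_time/= in_itv.
(* A test function touching a [K]-Lipschitz function has gradient coordinates bounded by [K], where
   truncation is the identity: the inequalities for [HK] are those for [H]. *)
have grad_sub phi p : C1_on (space_time `]0, T[) phi -> space_time `]0, T[ p ->
    (\forall q \near p, w q - phi q <= w p - phi p) ->
    HK (space_gradient phi p) = H (space_gradient phi p).
  move=> Cphi pD touch; rewrite /HK truncate_id// => j.
  apply: (@touching_gradient_le _ _ _ _ _ _ false (@open_space_time R n T) Cphi pD).
  apply: filterS touch => q wq qp; rewrite expr0.
  have /andP[p0 pT] := time_itv p pD.
  have pI : 0 <= p.2 <= T by rewrite !ltW.
  have := w_lipx q.1 p.1 p.2 pI; rewrite -{1}qp -!surjective_pairing -/K ler_norml; lra.
have grad_super phi p : C1_on (space_time `]0, T[) phi -> space_time `]0, T[ p ->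
    (\forall q \near p, w p - phi p <= w q - phi q) ->
    HK (space_gradient phi p) = H (space_gradient phi p).
  move=> Cphi pD touch; rewrite /HK truncate_id// => j.
  apply: (@touching_gradient_le _ _ _ _ _ _ true (@open_space_time R n T) Cphi pD).
  apply: filterS touch => q wq qp; rewrite expr1.
  have /andP[p0 pT] := time_itv p pD.
  have pI : 0 <= p.2 <= T by rewrite !ltW.
  have := w_lipx q.1 p.1 p.2 pI; rewrite -{1}qp -!surjective_pairing -/K ler_norml; lra.
exists w, I; split.
- split.
    exists B; split; first exact: num_real.
    move=> B' BB' p; rewrite /space_time/= in_itv/= => pT.
    exact: (le_trans (w_bound p pT) (ltW BB')).
  move=> e e0; exists (e / (`|C| + 1)); first by rewrite divr_gt0// ltr_wpDl.
  move=> p q; rewrite /space_time/= !in_itv/= => pT qT.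
  rewrite ltr_pdivlMr ?ltr_wpDl// => pq; apply: le_lt_trans pq.
  apply: (le_trans (w_lip p q pT qT)); rewrite mulrC ler_wpM2l//.
  by rewrite (le_trans (ler_norm _))// lerDl.
- by split=> [t _|s t _ _]; [have /andP[] := I_itv t|exact: I_homo].
- split=> phi p Cphi pD touch.
    have [aI aP] := lsc_envelopeP I_itv (time_itv p pD).
    by rewrite extend_rate_id// -(grad_sub phi p)//; exact: w_sub.
  have [aI aP] := usc_envelopeP I_itv (time_itv p pD).
  by rewrite extend_rate_id// -(grad_super phi p)//; exact: w_super.
- move=> t; rewrite in_itv/= => tT; apply/le_anti/andP; split.
    by apply/ereal_supP => _ [x _ <-]; rewrite lee_fin; exact: w_le0.
  apply/lee_addgt0Pr => e e0.
  have [x wx] := w_sup t e tT e0.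
  apply: (@le_trans _ _ ((w (x, t))%:E + e%:E)%E).
    by rewrite -EFinD lee_fin; lra.
  by rewrite leeD2r//; apply: ereal_sup_ubound; exists x.
- by split.
Qed.
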